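(* Let $K$ be a field of characteristic $0$, let $A$ be a Cohen-Macaulay standard graded $K$-algebra of Krull dimension $d$, let $\Theta=\theta_1,\dots,\theta_d$ be a linear system of parameters for $A$, and let $r\ge 1$ be an integer. (i) If $r\geq\deg h_A(t)$, then $A_\Theta^{\langle r\rangle}$ is almost weak Lefschetz. (ii) If $d$ is even and $r\geq\max\{d,\,2\deg h_A(t)-d\}$, then $A_\Theta^{\langle r\rangle}$ has the weak Lefschetz property. (iii) If $d$ is odd, $r\geq\frac d2$ and $\deg h_A(t)\leq\frac d2$, then $A_\Theta^{\langle r\rangle}$ has the weak Lefschetz property.
   Context: A standard graded $K$-algebra is a commutative graded $K$-algebra $A=\bigoplus_{i\ge 0}A_i$ with $A_0=K$ that is generated as a $K$-algebra by the finite-dimensional space $A_1$. Its Hilbert series $\mathrm{Hilb}(A,t)=\sum_{i\ge0}(\dim_K A_i)t^i$ has the form $(h_0+h_1t+\cdots+h_\sigma t^\sigma)/(1-t)^d$, where $d=\dim A$ is the Krull dimension and the $h_i$ are integers; the polynomial $h_A(t)=h_0+h_1t+\cdots+h_\sigma t^\sigma$ (with $h_\sigma\neq 0$) is the $h$-polynomial of $A$. For an integer $r\ge1$, the $r$th Veronese subalgebra is $A^{\langle r\rangle}=\bigoplus_{i\ge0}A_{ir}$, graded by $(A^{\langle r\rangle})_i=A_{ir}$. A linear system of parameters (l.s.o.p.) for $A$ with $\dim A=d$ is a sequence $\Theta=\theta_1,\dots,\theta_d\in A_1$ such that $\dim_K A/\Theta A<\infty$. For such $\Theta$, set $A_\Theta^{\langle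 r\rangle}:=A^{\langle r\rangle}/(\theta_1^rA^{\langle r\rangle}+\cdots+\theta_d^rA^{\langle r\rangle})$; this is a standard graded Artinian $K$-algebra with the induced grading. Let $B=\bigoplus_{i=0}^{s}B_i$ be a standard graded Artinian $K$-algebra with $\dim_K B_s>0$ (and $B_i=0$ for $i>s$). $B$ has the weak Lefschetz property if there is a linear form $w\in B_1$ such that for every $i\ge0$ the multiplication map $w:B_i\to B_{i+1}$ is injective or surjective. $B$ is almost weak Lefschetz if there are an integer $1\le p<s$ and a linear form $w\in B_1$ such that the multiplication map $w:B_i\to B_{i+1}$ is injective for $0\le i\le p-1$ and surjective for all $i\ge p+1$ (no condition is imposed on $w:B_p\to B_{p+1}$).
   Formalization: Part (i) is stated only when the top degree s of the quotient algebra is at least 2: for s ≤ 1 no integer p with 1 ≤ p < s exists, so the almost weak Lefschetz property as defined fails (e.g. A = K[x], Θ = x, r = 1). *)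

(* Defs.v *)
From HB Require Import structures.
From mathcomp Require Import all_boot all_order all_algebra.
From mathcomp Require Import boolp.

Set Implicit Arguments.
Unset Strict Implicit.
Unset Printing Implicit Defensive.

Import GRing.Theory.
Local Open Scope ring_scope.
Local Open Scope quotient_scope.

Section LinearAlgebra.
Variables (K : fieldType) (V : lmodType K).

(* The sum (not necessarily direct) of the subspaces W 0, W 1, ... *)
Definition sum_pred (W : nat -> {pred V}) : {pred V} := fun x =>
  `[< exists n (y : nat -> V),
        (forall i, y i \in W i) /\ x = \sum_(i < n) y i >].

Definition has_dim (W : {pred V}) (n : nat) : Prop :=
  exists b : 'I_n -> V,
    [/\ forall i, b i \in W,
        forall c : 'I_n -> K, \sum_i c i *: b i = 0 -> forall i, c i = 0
      & forall v, v \in W -> exists c : 'I_n -> K, v = \sum_i c i *: b i].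

Definition finite_dim (W : {pred V}) : Prop := exists n, has_dim W n.

End LinearAlgebra.

HB.mixin Record isGradedAlgebra (K : fieldType) A of GRing.ComAlgebra K A := {
  hpart : nat -> {pred A};
  hpart_submod : forall i, submod_closed (hpart i);
  hpart1 : 1 \in hpart 0;
  hpartM : forall i j x y,
    x \in hpart i -> y \in hpart j -> x * y \in hpart (i + j);
  hpart_sum : forall x, x \in sum_pred hpart;
  hpart_direct : forall n (y : nat -> A), (forall i, y i \in hpart i) ->
    \sum_(i < n) y i = 0 -> forall i, (i < n)%N -> y i = 0
}.

#[short(type="gradedAlgType")]
HB.structure Definition GradedAlgebra (K : fieldType) :=
  {A of isGradedAlgebra K A & GRing.ComAlgebra K A}.

Arguments hpart {K A} i : rename.
Arguments hpartM {K A i j x y} : rename.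
Arguments hpart_direct {K A n y} _ _ {i} _ : rename.

Section SumPred.
Variables (K : fieldType) (V : lmodType K) (W : nat -> {pred V}).
Hypothesis W_submod : forall i, submod_closed (W i).

Lemma submod_mem0 i : 0 \in W i. Proof. by case: (W_submod i). Qed.

Lemma submod_memP a i x y : x \in W i -> y \in W i -> a *: x + y \in W i.
Proof. by case: (W_submod i) => _ h; exact: h. Qed.

Lemma sum_predP x : x \in sum_pred W -> exists n (y : nat -> V),
  [/\ forall i, y i \in W i, forall i, (n <= i)%N -> y i = 0
    & forall N, (n <= N)%N -> x = \sum_(i < N) y i].
Proof.
move=> /asboolP[n [y [yW xE]]].
exists n, (fun i => if (i < n)%N then y i else 0); split.
- by move=> i; case: ifP => // _; exact: submod_mem0.
- by move=> i; rewrite leqNgt => /negbTE ->.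
- move=> N nN; rewrite xE (big_ord_widen N y nN) big_mkcond /=.
  by apply: eq_bigr => i _.
Qed.

Lemma sum_pred_submod : submod_closed (sum_pred W).
Proof.
split.
  by apply/asboolP; exists 0%N, (fun=> 0); rewrite big_ord0; split=> // i; exact: submod_mem0.
move=> a x y /sum_predP[n [x' [x'W _ xE]]] /sum_predP[m [y' [y'W _ yE]]].
apply/asboolP; exists (maxn n m), (fun i => a *: x' i + y' i); split.
  by move=> i; exact: submod_memP.
by rewrite (xE _ (leq_maxl n m)) (yE _ (leq_maxr n m)) big_split scaler_sumr.
Qed.

Lemma sum_pred_part i x : x \in W i -> x \in sum_pred W.
Proof.
move=> xW; apply/asboolP; exists i.+1, (fun j => if j == i then x else 0); split.
  by move=> j; case: eqP => [->//|_]; exact: submod_mem0.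
rewrite big_ord_recr /= eqxx big1 ?add0r// => j _.
by rewrite ltn_eqF// ltn_ord.
Qed.

End SumPred.

Section GradedTheory.
Variables (K : fieldType) (A : gradedAlgType K).
Implicit Types (x y : A) (i j : nat).

Let hs i : submod_closed (hpart (A := A) i) := hpart_submod i.

Lemma hpart0 i : 0 \in hpart (A := A) i.
Proof. exact: (submod_mem0 hs). Qed.

Lemma hpartD i x y : x \in hpart i -> y \in hpart i -> x + y \in hpart i.
Proof. by move=> hx hy; rewrite -[x]scale1r; exact: (submod_memP hs 1 hx hy). Qed.

Lemma hpartZ a i x : x \in hpart i -> a *: x \in hpart i.
Proof. by move=> hx; rewrite -[_ *: _]addr0; exact: (submod_memP hs a hx (hpart0 i)). Qed.

Lemma hpart_sumr (I : Type) (s : seq I) (P : pred I) (F : I -> A) i :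
  (forall k, P k -> F k \in hpart i) -> \sum_(k <- s | P k) F k \in hpart i.
Proof.
by move=> h; apply: (big_ind (fun x => x \in hpart i)) => //; [exact: hpart0|move=> x y; exact: hpartD].
Qed.

Lemma hpartX i x n : x \in hpart i -> x ^+ n \in hpart (n * i).
Proof.
move=> hx; elim: n => [|n IHn]; first by rewrite expr0 mul0n hpart1.
by rewrite exprS mulSn; exact: hpartM.
Qed.

Lemma hpart_direct_inj n (e : nat -> nat) (y : nat -> A) : injective e ->
  (forall i, y i \in hpart (e i)) ->
  \sum_(i < n) y i = 0 -> forall i, (i < n)%N -> y i = 0.
Proof.
move=> e_inj yh y0 i ltin.
pose N := (\max_(i < n) e i).+1.
have eN (k : 'I_n) : (e k < N)%N by rewrite ltnS; exact: leq_bigmax.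
pose z j := \sum_(k < n | e k == j) y k.
have zh j : z j \in hpart j by apply: hpart_sumr => k /eqP <-.
have zsum : \sum_(j < N) z j = 0.
  rewrite -[RHS]y0 (partition_big (fun k => Ordinal (eN k)) xpredT)//=.
have := hpart_direct zh zsum (eN (Ordinal ltin)).
by rewrite /z (big_pred1 (Ordinal ltin))// => k /=; rewrite (inj_eq e_inj).
Qed.

End GradedTheory.

Section GradedNotions.
Variables (K : fieldType) (A : gradedAlgType K).

Definition standard_graded : Prop :=
  [/\ forall x : A, x \in hpart 0 -> exists a : K, x = a%:A,
      finite_dim (hpart (A := A) 1)
    & forall S : {pred A}, subalg_closed S -> {subset hpart 1 <= S} ->
        forall x, x \in S].

Definition gen_ideal n (f : 'I_n -> A) : {pred A} := fun x =>
  `[< exists c : 'I_n -> A, x = \sum_i c i * f i >].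

Definition prime_chain (n : nat) : Prop :=
  exists P : nat -> {pred A},
    (forall i, (i <= n)%N -> idealr_closed (P i) /\ prime_idealr_closed (P i)) /\
    (forall i, (i < n)%N ->
       {subset P i <= P i.+1} /\ exists2 x, x \in P i.+1 & x \notin P i).

Definition krull_dim (d : nat) : Prop :=
  prime_chain d /\ forall n, prime_chain n -> (n <= d)%N.

Definition irrelevant_ideal : {pred A} := sum_pred (fun i => hpart (A := A) i.+1).

Definition regular_sequence n (f : 'I_n -> A) : Prop :=
  1 \notin gen_ideal f /\
  forall (i : 'I_n) (x : A),
    let I := gen_ideal (fun j : 'I_i => f (widen_ord (ltnW (ltn_ord i)) j)) in
    f i * x \in I -> x \in I.

(* Depth is the grade of the irrelevant ideal. *)
Definition depth (n : nat) : Prop :=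
  (exists f : 'I_n -> A,
     (forall i, f i \in irrelevant_ideal) /\ regular_sequence f) /\
  forall m (f : 'I_m -> A),
    (forall i, f i \in irrelevant_ideal) -> regular_sequence f -> (m <= n)%N.

Definition cohen_macaulay : Prop := exists2 d, krull_dim d & depth d.

(* Hilb(A,t) * (1 - t)^d = h(t) as formal power series, with d = dim A. *)
Definition h_polynomial (h : {poly int}) : Prop :=
  exists (d : nat) (H : nat -> nat),
    [/\ krull_dim d,
        forall i, has_dim (hpart (A := A) i) (H i)
      & forall n, h`_n = \sum_(k < n.+1) ((1 - 'X) ^+ d)`_k * (H (n - k)%N)%:Z].

Definition mul_injective (w : A) (i : nat) : Prop :=
  {in hpart i &, injective (fun x => w * x)}.

Definition mul_surjective (w : A) (i : nat) : Prop :=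
  forall y, y \in hpart i.+1 -> exists2 x, x \in hpart i & w * x = y.

Definition top_degree (s : nat) : Prop :=
  (exists2 x : A, x \in hpart s & x != 0) /\
  forall i, (s < i)%N -> forall x : A, x \in hpart i -> x = 0.

Definition weak_lefschetz : Prop :=
  exists2 w : A, w \in hpart 1 &
    forall i, mul_injective w i \/ mul_surjective w i.

(* No p exists when the top degree s is at most 1, so the property then fails. *)
Definition almost_weak_lefschetz : Prop :=
  exists s, top_degree s /\
    exists (p : nat) (w : A),
      [/\ (1 <= p < s)%N, w \in hpart 1,
          forall i, (i < p)%N -> mul_injective w i
        & forall i, (p < i)%N -> mul_surjective w i].

End GradedNotions.

Section Quotient.
Variables (K : fieldType) (A : gradedAlgType K) (n : nat) (f : 'I_n -> A).

Definition homogeneous_pos : Prop :=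
  forall i, exists2 e, (0 < e)%N & f i \in hpart e.

Lemma gen_ideal_components : homogeneous_pos -> forall x, x \in gen_ideal f ->
  exists N (z : nat -> A),
    [/\ forall i, z i \in hpart i, forall i, z i \in gen_ideal f, z 0%N = 0,
        forall i, (N <= i)%N -> z i = 0
      & forall M, (N <= M)%N -> x = \sum_(i < M) z i].
Proof.
move=> fP x /asboolP[c xE].
have /choice[e eP] : forall k, exists e, (0 < e)%N && (f k \in hpart e).
  by move=> k; have [e e0 fe] := fP k; exists e; rewrite e0.
have cP k := sum_predP (@hpart_submod K A) (hpart_sum (c k)).
have /choice[m /choice[y yP]] := cP.
pose N := (\max_k (m k + e k)).+1.
pose z i := \sum_k (if (e k <= i)%N then y k (i - e k)%N * f k else 0).
exists N, z; split.
- move=> i; apply: hpart_sumr => k _; case: ifP => [le|_]; last exact: hpart0.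
  rewrite -[i in hpart i](subnK le); apply: hpartM.
    by case: (yP k) => h _ _; exact: h.
  by case/andP: (eP k).
- move=> i; apply/asboolP.
  exists (fun k => if (e k <= i)%N then y k (i - e k)%N else 0).
  by apply: eq_bigr => k _; case: ifP; rewrite ?mul0r.
- rewrite /z big1// => k _; case: ifP => //.
  by case/andP: (eP k) => e0 _; rewrite leqn0 => /eqP e0'; rewrite e0' in e0.
- move=> i Ni; rewrite /z big1// => k _; case: ifP => // le.
  have mi : (m k <= i - e k)%N.
    rewrite leq_subRL// addnC (leq_trans _ (leq_trans (leqnSn _) Ni))//.
    exact: (leq_bigmax (F := fun k => (m k + e k)%N)).
  by case: (yP k) => _ -> //; rewrite mul0r.
- move=> M NM; rewrite exchange_big xE; apply: eq_bigr => k _ /=.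
  have mM : (m k + e k <= M)%N.
    rewrite (leq_trans _ (leq_trans (leqnSn _) NM))//.
    exact: (leq_bigmax (F := fun k => (m k + e k)%N)).
  have eM : (e k <= M)%N by rewrite (leq_trans _ mM)// leq_addl.
  have mM' : (m k <= M - e k)%N by rewrite leq_subRL// addnC.
  case: (yP k) => _ _ /(_ _ mM') {1}->.
  rewrite mulr_suml -(subnKC eM) big_split_ord /= [X in _ = X + _]big1 ?add0r.
    rewrite addKn; apply: eq_bigr => j _.
    by rewrite leq_addr addKn.
  by move=> j _; rewrite leqNgt ltn_ord.
Qed.

Lemma gen_ideal_homogeneous : homogeneous_pos -> forall m (x : nat -> A),
  (forall i, x i \in hpart i) -> \sum_(i < m) x i \in gen_ideal f ->
  forall i, (i < m)%N -> x i \in gen_ideal f.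
Proof.
move=> fP m x xh /(gen_ideal_components fP)[N [z [zh zI _ z0 zE]]] i im.
pose M := maxn N m.
pose x' i := if (i < m)%N then x i else 0.
pose d i := -1 *: z i + x' i.
have dh j : d j \in hpart j.
  apply: hpartD; first exact: hpartZ.
  by rewrite /x'; case: ifP => _; [exact: xh|exact: hpart0].
have d0 : \sum_(j < M) d j = 0.
  rewrite big_split -scaler_sumr /= -(zE _ (leq_maxl N m)).
  rewrite scaleN1r (big_ord_widen M x (leq_maxr N m)) big_mkcond /=.
  by rewrite addNr.
have := hpart_direct dh d0 (leq_trans im (leq_maxr N m)).
by rewrite /d /x' im scaleN1r => /eqP; rewrite addrC subr_eq0 => /eqP ->.
Qed.

(* The proof argument is there to carry the ideal structure. *)
Definition hideal (fP : homogeneous_pos) : {pred A} := gen_ideal f.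

Variable fP : homogeneous_pos.

Lemma hideal_closed : idealr_closed (hideal fP).
Proof.
split.
- by apply/asboolP; exists (fun=> 0); rewrite big1// => i _; rewrite mul0r.
- apply/negP => /(gen_ideal_components fP)[N [z [zh zI z0 zN zE]]].
  pose d i := -1 *: z i + (if i == 0%N then 1 else 0).
  have dh j : d j \in hpart j.
    apply: hpartD; first exact: hpartZ.
    by case: eqP => [->|_]; [exact: hpart1|exact: hpart0].
  have d0 : \sum_(j < N.+1) d j = 0.
    rewrite big_split -scaler_sumr /= -(zE _ (leqnSn N)) scaleN1r.
    by rewrite big_ord_recl /= big1 ?addr0 ?addNr.
  have := hpart_direct dh d0 (ltn0Sn N).
  by rewrite /d z0 scaler0 add0r => /eqP; rewrite oner_eq0.
- move=> a x y /asboolP[c ->] /asboolP[c' ->]; apply/asboolP.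
  exists (fun i => a * c i + c' i); rewrite mulr_sumr -big_split /=.
  by apply: eq_bigr => i _; rewrite mulrDl mulrA.
Qed.

HB.instance Definition _ := isIdealr.Build A (hideal fP) hideal_closed.

Definition gquot : Type := {ideal_quot (hideal fP)}.
HB.instance Definition _ := GRing.ComNzRing.on gquot.

Local Notation pi x := (\pi_({ideal_quot (hideal fP)}) x : gquot).

Lemma gquot_eq x y : (pi x == pi y) = (x - y \in hideal fP).
Proof. by rewrite Quotient.idealrBE. Qed.

Lemma gquotP (q : gquot) : exists x, q = pi x.
Proof. by exists (repr q); rewrite reprK. Qed.

Lemma gquotD x y : pi (x + y) = pi x + pi y.
Proof. by rewrite !piE. Qed.

Lemma gquotM x y : pi (x * y) = pi x * pi y.
Proof. by rewrite !piE. Qed.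

Lemma gquot1 : pi 1 = 1. Proof. by rewrite !piE. Qed.
Lemma gquot0 : pi 0 = 0. Proof. by rewrite !piE. Qed.

Definition gquot_scale (a : K) (q : gquot) : gquot := pi (a *: repr q).

Lemma gquot_scaleE a x : gquot_scale a (pi x) = pi (a *: x).
Proof.
apply/eqP; rewrite gquot_eq -scalerBr -mulr_algl -[X in X \in _]addr0.
have [h0 _ h] := hideal_closed; apply: h => //.
by rewrite -gquot_eq reprK.
Qed.

Lemma gquot_scaleA a b q : gquot_scale a (gquot_scale b q) = gquot_scale (a * b) q.
Proof. by have [x ->] := gquotP q; rewrite !gquot_scaleE scalerA. Qed.

Lemma gquot_scale1 : left_id 1 gquot_scale.
Proof. by move=> q; have [x ->] := gquotP q; rewrite !gquot_scaleE scale1r. Qed.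

Lemma gquot_scaleDr : right_distributive gquot_scale +%R.
Proof.
move=> a p q; have [x ->] := gquotP p; have [y ->] := gquotP q.
by rewrite -gquotD !gquot_scaleE scalerDr gquotD.
Qed.

Lemma gquot_scaleDl q : {morph gquot_scale^~ q : a b / a + b}.
Proof.
by move=> a b /=; have [x ->] := gquotP q; rewrite !gquot_scaleE scalerDl gquotD.
Qed.

HB.instance Definition _ := GRing.Zmodule_isLmodule.Build K gquot
  gquot_scaleA gquot_scale1 gquot_scaleDr gquot_scaleDl.

Lemma gquotZ a x : pi (a *: x) = a *: pi x.
Proof. by rewrite -gquot_scaleE. Qed.

Lemma gquot_scaleAl (a : K) (p q : gquot) : a *: (p * q) = a *: p * q.
Proof.
have [x ->] := gquotP p; have [y ->] := gquotP q.
by rewrite -gquotM -!gquotZ -gquotM scalerAl.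
Qed.

HB.instance Definition _ := GRing.Lmodule_isLalgebra.Build K gquot gquot_scaleAl.
HB.instance Definition _ := GRing.Lalgebra_isComAlgebra.Build K gquot.

Definition gquot_hpart (i : nat) : {pred gquot} := fun q =>
  `[< exists2 x : A, x \in hpart i & q = pi x >].

Lemma gquot_hpart_submod i : submod_closed (gquot_hpart i).
Proof.
split; first by apply/asboolP; exists 0; [exact: hpart0|rewrite gquot0].
move=> a p q /asboolP[x hx ->] /asboolP[y hy ->]; apply/asboolP.
by exists (a *: x + y); [apply: hpartD => //; exact: hpartZ|rewrite gquotD gquotZ].
Qed.

Lemma gquot_hpart1 : 1 \in gquot_hpart 0.
Proof. by apply/asboolP; exists 1; [exact: hpart1|rewrite gquot1]. Qed.

Lemma gquot_hpartM i j p q :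
  p \in gquot_hpart i -> q \in gquot_hpart j -> p * q \in gquot_hpart (i + j).
Proof.
move=> /asboolP[x hx ->] /asboolP[y hy ->]; apply/asboolP.
by exists (x * y); [exact: hpartM|rewrite gquotM].
Qed.

Lemma gquot_sumE m (y : nat -> A) : pi (\sum_(i < m) y i) = \sum_(i < m) pi (y i).
Proof.
elim: m => [|m IHm]; first by rewrite !big_ord0 gquot0.
by rewrite !big_ord_recr /= gquotD IHm.
Qed.

Lemma gquot_hpart_sum q : q \in sum_pred gquot_hpart.
Proof.
have [x ->] := gquotP q; have /asboolP[m [y [yh ->]]] := hpart_sum x.
apply/asboolP; exists m, (fun i => pi (y i)); split; last exact: gquot_sumE.
by move=> i; apply/asboolP; exists (y i).
Qed.

Lemma gquot_hpart_direct m (y : nat -> gquot) : (forall i, y i \in gquot_hpart i) ->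
  \sum_(i < m) y i = 0 -> forall i, (i < m)%N -> y i = 0.
Proof.
move=> yh y0 i im.
have /choice[x xP] : forall j, exists x, x \in hpart j /\ y j = pi x.
  by move=> j; have /asboolP[x hx ->] := yh j; exists x.
have xh j : x j \in hpart j by case: (xP j).
have xI : \sum_(j < m) x j \in gen_ideal f.
  rewrite -[X in X \in _]subr0 -[_ \in _]gquot_eq gquot_sumE gquot0.
  by apply/eqP; rewrite -[RHS]y0; apply: eq_bigr => j _; case: (xP j).
have := gen_ideal_homogeneous fP xh xI im.
case: (xP i) => _ ->; rewrite -[x i in X in X -> _]subr0 -[_ \in _]gquot_eq.
by move=> /eqP ->; exact: gquot0.
Qed.

HB.instance Definition _ := isGradedAlgebra.Build K gquot
  gquot_hpart_submod gquot_hpart1 gquot_hpartM gquot_hpart_sum gquot_hpart_direct.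

End Quotient.

Section Veronese.
Variables (K : fieldType) (A : gradedAlgType K) (r : nat).

Definition veronese_pred : {pred A} := sum_pred (fun i => hpart (A := A) (i * r)).

Let vs i : submod_closed (hpart (A := A) (i * r)) := hpart_submod (i * r).

Lemma veronese_subalg : subalg_closed veronese_pred.
Proof.
have [v0 vP] := sum_pred_submod vs.
have vsum n (F : 'I_n -> A) : (forall k, F k \in veronese_pred) ->
    \sum_k F k \in veronese_pred.
  move=> h; apply: (big_ind (fun x => x \in veronese_pred)) => // x y hx hy.
  by rewrite -[x]scale1r; exact: vP.
split=> //.
- by apply: (sum_pred_part vs (i := 0)); rewrite mul0n hpart1.
- move=> x y /asboolP[n [x' [xh ->]]] /asboolP[m [y' [yh ->]]].
  rewrite mulr_suml; apply: (vsum) => i; rewrite mulr_sumr; apply: (vsum) => j.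
  by apply: (sum_pred_part vs (i := (i + j)%N)); rewrite mulnDl; exact: hpartM.
Qed.

HB.instance Definition _ := GRing.isSubalgClosed.Build K A veronese_pred
  veronese_subalg.

(* For r = 0 the family (A_{ir})_i is not a grading. *)
Record veronese (r_gt0 : (0 < r)%N) : Type := Veronese {
  veronese_val :> A;
  veronese_valP : veronese_val \in veronese_pred
}.

Variable r_gt0 : (0 < r)%N.
Local Notation V := (veronese r_gt0).

HB.instance Definition _ := [isSub for @veronese_val r_gt0].
HB.instance Definition _ := [Choice of V by <:].
HB.instance Definition _ := [SubChoice_isSubComNzRing of V by <:].
HB.instance Definition _ := [SubZmodule_isSubLmodule of V by <:].
HB.instance Definition _ := [SubNzRing_SubLmodule_isSubLalgebra of V by <:].
HB.instance Definition _ := GRing.Lalgebra_isComAlgebra.Build K V.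

Definition veronese_hpart (i : nat) : {pred V} := fun x => \val x \in hpart (i * r).

Lemma veronese_hpart_submod i : submod_closed (veronese_hpart i).
Proof.
split; first by rewrite unfold_in /= hpart0.
by move=> a x y hx hy; rewrite unfold_in /=; apply: hpartD => //; exact: hpartZ.
Qed.

Lemma veronese_hpart1 : 1 \in veronese_hpart 0.
Proof. by rewrite unfold_in /= mul0n hpart1. Qed.

Lemma veronese_hpartM i j x y : x \in veronese_hpart i -> y \in veronese_hpart j ->
  x * y \in veronese_hpart (i + j).
Proof. by move=> hx hy; rewrite unfold_in /= mulnDl; exact: hpartM. Qed.

Lemma veronese_sumE m (y : nat -> V) :
  \val (\sum_(i < m) y i) = \sum_(i < m) \val (y i) :> A.
Proof.
elim: m => [|m IHm]; first by rewrite !big_ord0.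
by rewrite !big_ord_recr /= -IHm.
Qed.

Lemma veronese_hpart_sum x : x \in sum_pred veronese_hpart.
Proof.
have /asboolP[m [y [yh xE]]] := veronese_valP x.
have yv i : y i \in veronese_pred by exact: (sum_pred_part vs (i := i)).
pose z i := Veronese r_gt0 (yv i).
apply/asboolP; exists m, z; split=> //.
apply: val_inj; have h := veronese_sumE m z.
exact (etrans xE (esym h)).
Qed.

Lemma veronese_hpart_direct m (y : nat -> V) : (forall i, y i \in veronese_hpart i) ->
  \sum_(i < m) y i = 0 -> forall i, (i < m)%N -> y i = 0.
Proof.
move=> yh y0 i im; apply: val_inj.
have inj : injective (muln^~ r).
  by move=> a b /eqP; rewrite /= eqn_pmul2r// => /eqP.
apply: (hpart_direct_inj inj (y := fun i => \val (y i)) yh _ im).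
by rewrite -veronese_sumE y0.
Qed.

HB.instance Definition _ := isGradedAlgebra.Build K V
  veronese_hpart_submod veronese_hpart1 veronese_hpartM veronese_hpart_sum
  veronese_hpart_direct.

End Veronese.

Arguments veronese_pred {K} A r.
Arguments veronese {K} A {r} r_gt0.

Section LinearSystems.
Variables (K : fieldType) (A : gradedAlgType K) (d : nat).

Lemma linear_homogeneous (f : 'I_d -> A) :
  (forall i, f i \in hpart 1) -> homogeneous_pos f.
Proof. by move=> h i; exists 1%N. Qed.

(* That d is the Krull dimension of A is a separate hypothesis. *)
Record lsop : Type := Lsop {
  lsop_val :> 'I_d -> A;
  lsop_linear : forall i, lsop_val i \in hpart 1;
  lsop_finite : finite_dim (predT : {pred gquot (linear_homogeneous lsop_linear)})
}.

Variables (Theta : lsop) (r : nat) (r_gt0 : (0 < r)%N).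

Lemma lsop_pow_hpart i : Theta i ^+ r \in hpart (1 * r).
Proof. by rewrite mulnC; apply: hpartX; exact: lsop_linear. Qed.

Lemma lsop_pow_veronese i : Theta i ^+ r \in veronese_pred A r.
Proof.
apply: (sum_pred_part (fun i => hpart_submod (i * r))).
exact: lsop_pow_hpart.
Qed.

Definition lsop_pow (i : 'I_d) : veronese A r_gt0 :=
  Veronese r_gt0 (lsop_pow_veronese i).

Lemma lsop_pow_homogeneous : homogeneous_pos lsop_pow.
Proof. by move=> i; exists 1%N => //; exact: lsop_pow_hpart. Qed.

(* A_Theta^<r> *)
Definition veronese_quot : gradedAlgType K := gquot lsop_pow_homogeneous.

End LinearSystems.

(* Main.v *)
Require Import Defs.
From HB Require Import structures.
From mathcomp Require Import all_boot all_order all_algebra.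
From mathcomp Require Import boolp mpoly.
From mathcomp Require Import ring zify.

Set Implicit Arguments.
Unset Strict Implicit.
Unset Printing Implicit Defensive.

Import GRing.Theory.
Local Open Scope ring_scope.

(** A Cohen-Macaulay algebra is a free module over the polynomial ring generated
    by a linear system of parameters, and this reduces the theorem to the strong
    Lefschetz property of a monomial complete intersection.

    Let S = K[X_1, ..., X_d] act on A through X_i |-> theta_i, and let the
    elements b_k of A, homogeneous of degrees delta_k, lift a K-basis of
    A / Theta A. They generate A over S ([hom_row_span]), and they form a basis:
    - A has a regular sequence of length d in its irrelevant ideal, and a power
      of each of its members lies in (Theta), because A / Theta A is
      finite-dimensional ([irrelevant_nilp]). Since (Theta) annihilates the
      Koszul homology of Theta, dividing out one member at a time gives
      H_1(Theta; A) = 0 ([regular_kexact]).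
    - H_1(Theta; A) is Tor_1 of K and A over S, so the kernel of the map S^n -> A
      given by the b_k equals its product with the ideal S_+ and hence vanishes
      ([free_eval_injective]).
    Comparing Hilbert series, the coefficient h_m is the number of k with
    delta_k = m; thus delta_k <= deg h for all k ([delta_le]).

    Consequently A / (theta_1^r, ..., theta_d^r) is a direct sum of copies,
    shifted by the delta_k, of T = S / (X_1^r, ..., X_d^r), whose top degree is
    N = d (r - 1). In characteristic 0, multiplication by l = X_1 + ... + X_d on T
    is the raising operator of an sl_2-action ([lower_lform]); therefore l^k maps
    T_a to T_(a+k) injectively if 2a + k <= N and surjectively if 2a + k >= N
    ([lefschetz_inj], [lefschetz_surj]).

    Let w be the class of (theta_1 + ... + theta_d)^r, a linear form of
    A_Theta^<r>. Reading off degrees, w is injective in degree i as soon as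
    (2i+1) r <= N and surjective as soon as (2i+1) r >= N + 2 deg h. In the second
    and third claims every i satisfies one of these inequalities; in the first
    claim at most one i fails both. *)

(** * The Koszul complex *)

Section Koszul.
Variables (R : comNzRingType) (V : lmodType R) (t : nat -> R).

(** The exterior algebra on n generators with coefficients in V: the pair (x, y)
    stands for x + y e_n. Encoding it by pairs makes every statement about the
    Koszul complex an induction along the mapping cone of the last t_n, with no
    signs attached to subsets of generators. *)
Fixpoint kos (n : nat) : lmodType R :=
  if n is n'.+1 then (kos n' * kos n')%type else V.

Definition kpair n (x y : kos n) : kos n.+1 := (x, y).

Variant kos_spec n : kos n.+1 -> Type := KPair x y : kos_spec (@kpair n x y).

Lemma kosP n (z : kos n.+1) : kos_spec z.
Proof. by case: z => x y; exact: (KPair x y). Qed.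

Lemma kpairZD n a (x y x' y' : kos n) :
  a *: kpair x y + kpair x' y' = kpair (a *: x + x') (a *: y + y').
Proof. by []. Qed.

(** The exterior degree is a predicate, so that chains of all degrees share one
    module. *)
Fixpoint kdeg n (i : nat) : kos n -> Prop :=
  match n return kos n -> Prop with
  | 0 => fun z => if i is 0 then True else z = 0
  | n'.+1 => fun z => @kdeg n' i z.1 /\
               (if i is j.+1 then @kdeg n' j z.2 else z.2 = 0)
  end.

(** The differential sends x + y e_n to dx + t_n y - (dy) e_n. The sign makes it
    square to zero without reference to the degree of y. *)
Fixpoint kd n : kos n -> kos n :=
  match n return kos n -> kos n with
  | 0 => fun _ => 0
  | n'.+1 => fun z => kpair (@kd n' z.1 + t n' *: z.2) (- @kd n' z.2)
  end.

(** Exterior multiplication by e_j on the left. *)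
Fixpoint kwedge j n : kos n -> kos n :=
  match n return kos n -> kos n with
  | 0 => fun _ => 0
  | n'.+1 => fun z =>
      if j == n' then kpair 0 z.1 else kpair (@kwedge j n' z.1) (- @kwedge j n' z.2)
  end.

Fixpoint kall (P : V -> Prop) n : kos n -> Prop :=
  match n return kos n -> Prop with
  | 0 => P
  | n'.+1 => fun z => @kall P n' z.1 /\ @kall P n' z.2
  end.

Fixpoint kcst n (v : V) : kos n :=
  match n return kos n with 0 => v | n'.+1 => kpair (kcst n' v) 0 end.

Lemma kd_pair n (x y : kos n) : kd (kpair x y) = kpair (kd x + t n *: y) (- kd y).
Proof. by []. Qed.

Lemma kwedge_pair j n (x y : kos n) :
  kwedge j (kpair x y) =
    if j == n then kpair 0 x else kpair (kwedge j x) (- kwedge j y).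
Proof. by []. Qed.

Lemma kdeg_pair0 n (x y : kos n) : kdeg 0 (kpair x y) <-> kdeg 0 x /\ y = 0.
Proof. by []. Qed.

Lemma kdeg_pairS n i (x y : kos n) :
  kdeg i.+1 (kpair x y) <-> kdeg i.+1 x /\ kdeg i y.
Proof. by []. Qed.

Lemma kall_pair P n (x y : kos n) : kall P (kpair x y) <-> kall P x /\ kall P y.
Proof. by []. Qed.

Lemma kpair_inj n (x y x' y' : kos n) : x = x' -> y = y' -> kpair x y = kpair x' y'.
Proof. by move=> -> ->. Qed.

Lemma kd_linear n : linear (@kd n).
Proof.
elim: n => [|n IHn] a x y; first by rewrite scaler0 addr0.
case/kosP: x => x1 x2; case/kosP: y => y1 y2.
rewrite kpairZD !kd_pair kpairZD !IHn; apply: kpair_inj.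
  by rewrite !scalerDr !scalerA [t n * a]mulrC addrACA.
by rewrite opprD scalerN.
Qed.
HB.instance Definition _ n :=
  GRing.isLinear.Build R (kos n) (kos n) _ (@kd n) (@kd_linear n).

Lemma kwedge_linear j n : linear (@kwedge j n).
Proof.
elim: n => [|n IHn] a x y; first by rewrite scaler0 addr0.
case/kosP: x => x1 x2; case/kosP: y => y1 y2.
rewrite kpairZD !kwedge_pair; case: ifP => _; rewrite kpairZD ?IHn.
  by rewrite scaler0 addr0.
by rewrite opprD scalerN.
Qed.
HB.instance Definition _ j n :=
  GRing.isLinear.Build R (kos n) (kos n) _ (@kwedge j n) (@kwedge_linear j n).

Lemma kd_kd n (z : kos n) : kd (kd z) = 0.
Proof.
elim: n z => [|n IHn] z //; case/kosP: z => x y.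
rewrite !kd_pair linearD !linearN linearZ /= !IHn add0r subrr !oppr0.
by [].
Qed.

(** Multiplication by t_j is homotopic to zero, so it annihilates the homology. *)
Lemma kd_kwedge j n (z : kos n) : (j < n)%N ->
  kd (kwedge j z) + kwedge j (kd z) = t j *: z.
Proof.
elim: n z => [|n IHn] z // lejn; case/kosP: z => x y.
rewrite !kd_pair !kwedge_pair; case: (eqVneq j n) => [->|jn].
  rewrite kd_pair -[kpair _ _]scale1r kpairZD !scale1r linear0 add0r.
  by rewrite addr0 addKr.
rewrite kd_pair -[kpair _ _]scale1r kpairZD !scale1r [kwedge j (_ + _)]linearD /=.
rewrite [kwedge j (_ *: _)]linearZ [kwedge j (- _)]linearN [kd (- _)]linearN /=.
rewrite scalerN !opprK addrACA addNr addr0 !IHn //; by rewrite ltn_neqAle jn.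
Qed.

Lemma kdegZD n i a (x y : kos n) : kdeg i x -> kdeg i y -> kdeg i (a *: x + y).
Proof.
elim: n i x y => [|n IHn] [|i] x y //.
- by move=> /= -> ->; rewrite scaler0 addr0.
- case/kosP: x => x1 x2; case/kosP: y => y1 y2; rewrite kpairZD !kdeg_pair0.
  by case=> ? -> [? ->]; rewrite scaler0 addr0; split=> //; exact: IHn.
- case/kosP: x => x1 x2; case/kosP: y => y1 y2; rewrite kpairZD !kdeg_pairS.
  by case=> ? ? [? ?]; split; exact: IHn.
Qed.

Lemma kdeg_zero n i : kdeg i (0 : kos n).
Proof. by elim: n i => [|n IHn] [|i] //=; split => //; exact: IHn. Qed.

Lemma kdegZ n i a (x : kos n) : kdeg i x -> kdeg i (a *: x).
Proof. by move=> hx; rewrite -[_ *: _]addr0; exact: kdegZD (kdeg_zero _ _). Qed.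

Lemma kdegN n i (x : kos n) : kdeg i x -> kdeg i (- x).
Proof. by rewrite -scaleN1r; exact: kdegZ. Qed.

Lemma kdegD n i (x y : kos n) : kdeg i x -> kdeg i y -> kdeg i (x + y).
Proof. by rewrite -{2}[x]scale1r; exact: kdegZD. Qed.

Lemma kdegB n i (x y : kos n) : kdeg i x -> kdeg i y -> kdeg i (x - y).
Proof. by move=> hx hy; apply: kdegD => //; exact: kdegN. Qed.

Lemma kd_deg0 n (z : kos n) : kdeg 0 z -> kd z = 0.
Proof.
elim: n z => [|n IHn] z //; case/kosP: z => x y; rewrite kdeg_pair0 kd_pair.
by case=> h1 ->; rewrite scaler0 addr0 (IHn _ h1) [kd 0]linear0 oppr0.
Qed.

Lemma kdeg_kd n i (z : kos n) : kdeg i.+1 z -> kdeg i (kd z).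
Proof.
elim: n i z => [|n IHn] i z; first by case: i.
case/kosP: z => x y; rewrite kdeg_pairS kd_pair => -[h1 h2].
have h3 : kdeg i (kd x + t n *: y) by apply: kdegD; [exact: IHn|exact: kdegZ].
case: i h1 h2 h3 => [|i] h1 h2 h3.
  by split=> //; apply/eqP; rewrite oppr_eq0; apply/eqP; exact: kd_deg0.
by rewrite kdeg_pairS; split=> //; apply: kdegN; exact: IHn.
Qed.

Lemma kdeg_kwedge j n i (z : kos n) : kdeg i z -> kdeg i.+1 (kwedge j z).
Proof.
elim: n i z => [|n IHn] i z //; case/kosP: z => x y; rewrite kwedge_pair.
case: i => [|i]; rewrite ?kdeg_pair0 ?kdeg_pairS => -[h1 h2];
  case: ifP => _; rewrite kdeg_pairS; split=> //; try exact: kdeg_zero; try exact: IHn.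
  by rewrite h2 [kwedge j 0]linear0 oppr0; exact: kdeg_zero.
by apply: kdegN; exact: IHn.
Qed.

Lemma kdeg_large n i (z : kos n) : kdeg i z -> (n < i)%N -> z = 0.
Proof.
elim: n i z => [|n IHn] [|i] z //; case/kosP: z => x y.
rewrite kdeg_pairS => -[h1 h2] lt; apply: kpair_inj.
  by apply: IHn h1 _; exact: ltnW.
exact: IHn h2 _.
Qed.

Lemma kdeg_kcst n v : kdeg 0 (kcst n v).
Proof. by elim: n => [|n IHn]. Qed.

Lemma kcst_linear n : linear (kcst n).
Proof.
elim: n => [|n IHn] a x y //=.
by rewrite kpairZD scaler0 addr0 IHn.
Qed.
HB.instance Definition _ n :=
  GRing.isLinear.Build R V (kos n) _ (kcst n) (@kcst_linear n).

Section Submodule.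
Variable P : V -> Prop.
Hypotheses (P0 : P 0) (PZD : forall a x y, P x -> P y -> P (a *: x + y)).

Lemma kall0 n : kall P (0 : kos n).
Proof. by elim: n. Qed.

Lemma kallZD n a (x y : kos n) : kall P x -> kall P y -> kall P (a *: x + y).
Proof.
elim: n x y => [|n IHn] x y; first exact: PZD.
case/kosP: x => x1 x2; case/kosP: y => y1 y2; rewrite kpairZD !kall_pair.
by case=> ? ? [? ?]; split; exact: IHn.
Qed.

Lemma kallZ n a (x : kos n) : kall P x -> kall P (a *: x).
Proof. by move=> hx; rewrite -[_ *: _]addr0; exact: kallZD (kall0 _). Qed.

Lemma kallN n (x : kos n) : kall P x -> kall P (- x).
Proof. by rewrite -scaleN1r; exact: kallZ. Qed.

Lemma kallD n (x y : kos n) : kall P x -> kall P y -> kall P (x + y).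
Proof. by rewrite -{2}[x]scale1r; exact: kallZD. Qed.

Lemma kall_kd n (z : kos n) : kall P z -> kall P (kd z).
Proof.
elim: n z => [|n IHn] z; first by [].
case/kosP: z => x y; rewrite kd_pair !kall_pair => -[h1 h2].
split; last by apply: kallN; exact: IHn.
by apply: kallD; [exact: IHn|exact: kallZ].
Qed.

Lemma kall_kwedge j n (z : kos n) : kall P z -> kall P (kwedge j z).
Proof.
elim: n z => [|n IHn] z; first by [].
case/kosP: z => x y; rewrite kwedge_pair kall_pair => -[h1 h2].
case: ifP => _; rewrite kall_pair; split; try by [].
- exact: kall0.
- exact: IHn.
- by apply: kallN; exact: IHn.
Qed.

(** Boundaries of 1-chains with coefficients in P are the sums of the t_i P; this
    is how an exactness statement turns into a factorisation. *)
Lemma kd_deg1_kcst n (z : kos n) : kdeg 1 z -> kall P z ->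
  exists y : nat -> V, (forall i, P (y i)) /\
    kd z = kcst n (\sum_(i < n) t i *: y i).
Proof.
elim: n z => [|n IHn] z.
  by move=> _ _; exists (fun=> 0); rewrite big_ord0.
case/kosP: z => x v; rewrite kdeg_pairS kall_pair kd_pair => -[x1 v0] [Px Pv].
have [y [Py ->]] := IHn x x1 Px.
have [u [Pu ->]] : exists u, P u /\ v = kcst n u.
  elim: n v v0 Pv {x x1 Px IHn y Py} => [|n IHn] v; first by exists v.
  case/kosP: v => v w; rewrite kdeg_pair0 kall_pair => -[v0 ->] [Pv _].
  by have [u [Pu ->]] := IHn v v0 Pv; exists u.
exists (fun i => if i == n then u else y i); split; first by move=> i; case: ifP.
rewrite big_ord_recr /= eqxx linearD linearZ /= (kd_deg0 (kdeg_kcst _ _)) oppr0.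
congr kpair; congr (kcst _ _ + _); apply: eq_bigr => i _.
by rewrite ltn_eqF.
Qed.

Lemma kcst_kd_deg1 n (y : nat -> V) :
  exists2 z, kdeg 1 z & kd z = kcst n (\sum_(i < n) t i *: y i).
Proof.
elim: n => [|n [z z1 zE]]; first by exists 0; [|rewrite big_ord0].
exists (kpair z (kcst n (y n))); first by split=> //; exact: kdeg_kcst.
rewrite kd_pair zE big_ord_recr /= linearD linearZ /=.
by rewrite (kd_deg0 (kdeg_kcst _ _)) oppr0.
Qed.

End Submodule.

(** Vanishing of the i-th Koszul homology with coefficients in V / P. Computing
    modulo a predicate spares the successive quotient modules along a regular
    sequence. *)
Definition kexact P n i := forall z : kos n, kdeg i z -> kall P (kd z) ->
  exists2 w, kdeg i.+1 w & kall P (z - kd w).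

Section Step.
Variable P : V -> Prop.
Hypotheses (P0 : P 0) (PZD : forall a x y, P x -> P y -> P (a *: x + y)).
Variable n : nat.

Lemma ideal_kills_homology i (c : 'I_n -> R) (z : kos n) : kdeg i z -> kall P (kd z) ->
  exists2 w, kdeg i.+1 w & kall P ((\sum_j c j * t j) *: z - kd w).
Proof.
(* The null-homotopy of the combination of the t_j. *)
move=> zi zP; exists (\sum_j c j *: kwedge j z).
  apply: (big_ind (fun w : kos n => kdeg i.+1 w)); first exact: kdeg_zero.
    by move=> x y; exact: kdegD.
  by move=> j _; apply: kdegZ; exact: kdeg_kwedge.
rewrite scaler_suml linear_sum -sumrB.
apply: (big_ind (fun w : kos n => kall P w)); first exact: kall0.
  by move=> x y; exact: kallD.
move=> j _; rewrite linearZ -scalerA -(kd_kwedge z (ltn_ord j)) /= -scalerBr addrC addKr.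
by apply: kallZ => //; exact: kall_kwedge.
Qed.

(** A component of z outside the given degree is zero and can be lifted to zero,
    so the lift u keeps the degree of z. *)
Lemma kall_lift f k i (z : kos k) : kdeg i z ->
  kall (fun x => exists u, P (x - f *: u)) z ->
  exists2 u : kos k, kdeg i u & kall P (z - f *: u).
Proof.
have z0 l j : exists2 u : kos l, kdeg j u & kall P (0 - f *: u).
  by exists 0; [exact: kdeg_zero|rewrite scaler0 subr0; exact: kall0].
elim: k i z => [|k IHk] i z.
  by case: i => [_ [u Pu]|i /= -> _]; [exists u|exact: (z0 0 i.+1)].
case/kosP: z => x y; rewrite kall_pair.
case: i => [|i]; rewrite ?kdeg_pair0 ?kdeg_pairS => -[xi yi] [xP yP].
  have [u ui uP] := IHk _ _ xi xP; exists (kpair u 0).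
    by rewrite kdeg_pair0.
  split=> //=.
  by rewrite yi scaler0 subr0; exact: kall0.
have [u ui uP] := IHk _ _ xi xP; have [v vi vP] := IHk _ _ yi yP.
by exists (kpair u v).
Qed.

Lemma kall_quot f k (x y : kos k) : kall P (f *: x - y) ->
  kall (fun x => exists u, P (x - f *: u)) y.
Proof.
elim: k x y => [|k IHk] x y.
  move=> h; exists x; rewrite -opprB -scaleN1r -[_ *: _]addr0.
  exact: PZD.
case/kosP: x => x1 x2; case/kosP: y => y1 y2 [h1 h2].
by split; [exact: (IHk x1)|exact: (IHk x2)].
Qed.

(** By the long exact sequence of multiplication by f on V / P, vanishing of
    H_(i+1) modulo f makes f injective on H_i. A power of f lies in the ideal
    of the t_j, which annihilates H_i; hence H_i = 0. *)
Lemma kexact_of_regular_quot i f m (c : 'I_n -> R) :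
  (forall x, P (f *: x) -> P x) -> f ^+ m = \sum_j c j * t j ->
  kexact (fun x => exists u, P (x - f *: u)) n i.+1 -> kexact P n i.
Proof.
move=> freg fm ex z zi zP.
have [w wi wP] := ideal_kills_homology c zi zP; rewrite -fm in wP.
(* Regularity of f passes from coefficients to chains. *)
have fregn k (x : kos k) : kall P (f *: x) -> kall P x.
  elim: k x => [|k IHk] x; first exact: freg.
  by case/kosP: x => x y [h1 h2]; split; exact: IHk.
elim: m w wi wP {fm} => [|m IHm] w wi wP.
  by rewrite expr0 scale1r in wP; exists w.
(* As f^(m+1) z is the boundary of w modulo P, w is a cycle modulo f. *)
have exw : kall (fun x => exists u, P (x - f *: u)) (kd w).
  by apply: (kall_quot (x := f ^+ m *: z)); rewrite scalerA -exprS.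
have [v vi vP] := ex w wi exw.
have wvi : kdeg i.+1 (w - kd v) by apply: kdegB => //; exact: kdeg_kd.
have [u ui uP] := kall_lift wvi vP.
apply: (IHm u ui); apply: fregn.
have := kallD PZD wP (kall_kd P0 PZD uP).
rewrite !linearB linearZ /= kd_kd subr0 addrA subrK exprS -scalerA -scalerBr.
by [].
Qed.

End Step.

End Koszul.

(** * Change of coefficients in the Koszul complex *)

Section KoszulMap.
Variables (R R' : comNzRingType) (V : lmodType R) (W : lmodType R').
Variables (t : nat -> R) (t' : nat -> R') (phi : {additive V -> W}).
Hypothesis phiZ : forall i v, phi (t i *: v) = t' i *: phi v.

Fixpoint kmap n : kos V n -> kos W n :=
  match n return kos V n -> kos W n with
  | 0 => phi
  | n'.+1 => fun z => kpair (@kmap n' z.1) (@kmap n' z.2)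
  end.

Lemma kmap_pair n (x y : kos V n) : kmap (kpair x y) = kpair (kmap x) (kmap y).
Proof. by []. Qed.

Lemma kmap_additive n : additive (@kmap n).
Proof.
elim: n => [|n IHn] x y; first exact: raddfB.
case/kosP: x => x1 x2; case/kosP: y => y1 y2.
by apply: kpair_inj; exact: IHn.
Qed.
HB.instance Definition _ n :=
  GRing.isZmodMorphism.Build (kos V n) (kos W n) (@kmap n) (@kmap_additive n).

Lemma kmapZ n i (z : kos V n) : kmap (t i *: z) = t' i *: kmap z.
Proof.
elim: n z => [|n IHn] z; first exact: phiZ.
by case/kosP: z => x y; apply: kpair_inj; exact: IHn.
Qed.

Lemma kmap_kd n (z : kos V n) : kmap (kd t z) = kd t' (kmap z).
Proof.
elim: n z => [|n IHn] z; first exact: raddf0.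
case/kosP: z => x y; rewrite kmap_pair !kd_pair kmap_pair -!IHn -kmapZ.
by rewrite [kmap (_ + _)]raddfD [kmap (- _)]raddfN.
Qed.

Lemma kmap_kdeg n i (z : kos V n) : kdeg i z -> kdeg i (kmap z).
Proof.
elim: n i z => [|n IHn] [|i] z //; first by move=> /= ->; rewrite raddf0.
  by case/kosP: z => x y [h1 /= ->]; split; [exact: IHn|exact: raddf0].
by case/kosP: z => x y [h1 h2]; split; exact: IHn.
Qed.

Lemma kmap_kcst n v : kmap (kcst n v) = kcst n (phi v).
Proof. by elim: n => [|n IHn] //=; rewrite IHn raddf0. Qed.

Lemma kmap_ker n (z : kos V n) : kmap z = 0 -> kall (fun v => phi v = 0) z.
Proof.
elim: n z => [|n IHn] z //; case/kosP: z => x y [h1 h2].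
by split; exact: IHn.
Qed.

Lemma kmap_lift n i (w : kos W n) : (forall y, exists x, phi x = y) ->
  kdeg i w -> exists2 z, kdeg i z & kmap z = w.
Proof.
move=> surj; elim: n i w => [|n IHn] i w.
  case: i => [_|i /= ->]; last by exists 0 => //; exact: raddf0.
  by have [x <-] := surj w; exists x.
case/kosP: w => w1 w2; case: i => [|i].
  rewrite kdeg_pair0 => -[h1 ->]; have [z zi <-] := IHn _ _ h1.
  by exists (kpair z 0); rewrite ?kmap_pair ?raddf0.
rewrite kdeg_pairS => -[h1 h2].
by have [z zi <-] := IHn _ _ h1; have [y yi <-] := IHn _ _ h2; exists (kpair z y).
Qed.

End KoszulMap.

Lemma kcst_inj (R : comNzRingType) (V : lmodType R) n : injective (@kcst R V n).
Proof. by elim: n => [|n IHn] x y //= [] /IHn. Qed.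

Lemma kall_eq0 (R : comNzRingType) (V : lmodType R) n (z : kos V n) :
  kall (fun v => v = 0) z <-> z = 0.
Proof.
elim: n z => [|n IHn] z //; case/kosP: z => x y; rewrite kall_pair !IHn.
by split=> [[-> ->]|[-> ->]].
Qed.

(** Adapts a family over 'I_d to the Koszul complex, which is defined for
    sequences indexed by nat. *)
Definition zero_ext d (R : zmodType) (f : 'I_d -> R) (i : nat) : R :=
  oapp f 0 (insub i).

Lemma zero_extE d (R : zmodType) (f : 'I_d -> R) (i : 'I_d) : zero_ext f i = f i.
Proof. by rewrite /zero_ext valK. Qed.

(** * Koszul homology and regular sequences *)

Section GenIdeal.
Variables (K : fieldType) (A : gradedAlgType K) (n : nat) (f : 'I_n -> A).
Local Notation I := (gen_ideal f).

Lemma gen_ideal0 : 0 \in I.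
Proof. by apply/asboolP; exists (fun=> 0); rewrite big1// => i _; rewrite mul0r. Qed.

Lemma gen_idealMD a x y : x \in I -> y \in I -> a * x + y \in I.
Proof.
move=> /asboolP[c ->] /asboolP[c' ->]; apply/asboolP.
exists (fun i => a * c i + c' i); rewrite mulr_sumr -big_split /=.
by apply: eq_bigr => i _; rewrite mulrDl mulrA.
Qed.

Lemma gen_idealD x y : x \in I -> y \in I -> x + y \in I.
Proof. by move=> hx hy; rewrite -[x]mul1r; exact: gen_idealMD. Qed.

Lemma gen_idealZ (a : K) x : x \in I -> a *: x \in I.
Proof.
move=> hx; rewrite -mulr_algl -[_ * x]addr0.
by apply: gen_idealMD => //; exact: gen_ideal0.
Qed.

Lemma gen_ideal_sum (J : Type) (s : seq J) (P : pred J) (F : J -> A) :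
  (forall k, P k -> F k \in I) -> \sum_(k <- s | P k) F k \in I.
Proof.
move=> h; apply: (big_ind (fun x => x \in I)) => //; first exact: gen_ideal0.
by move=> x y; exact: gen_idealD.
Qed.

Lemma gen_ideal_eq x y : x = y -> x \in I -> y \in I.
Proof. by move=> ->. Qed.

End GenIdeal.

Section RegularExact.
Variables (K : fieldType) (A : gradedAlgType K).

(** Modulo f_0, ..., f_(k-1), the Koszul homology of theta vanishes in degrees
    above k. For k = d this holds as there are no chains above degree d, and
    each element removed from the sequence lowers the bound by one. *)
Lemma regular_kexact d (f theta : 'I_d -> A) :
  (forall i, exists m, f i ^+ m \in gen_ideal theta) -> regular_sequence f ->
  @kexact A A^o (zero_ext theta) (fun x => x = 0) d 1.
Proof.
move=> fnil [_ freg].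
pose P k (x : A^o) : Prop := x \in gen_ideal (fun j : 'I_k => zero_ext f j).
have P0 k : P k 0 by exact: gen_ideal0.
have PZD k (a : A) x y : P k x -> P k y -> P k (a *: x + y) by exact: gen_idealMD.
suff H j k i : (j + k = d)%N -> (k < i)%N ->
    @kexact A A^o (zero_ext theta) (P k) d i.
  have := H d 0%N 1%N (addn0 d) isT; congr (kexact _ _ _ _).
  apply/funext => x; apply/propext; split; last by move=> ->; exact: P0.
  by move/asboolP => [c ->]; rewrite big_ord0.
elim: j k i => [|j IHj] k i jk ki.
  move=> z zi _; exists 0; first exact: kdeg_zero.
  have -> : z = 0 by apply: (kdeg_large zi); rewrite -jk.
  rewrite sub0r [kd _ 0]linear0 oppr0; exact: (kall0 (P0 k)).
have kd' : (k < d)%N by rewrite -jk addSn ltnS leq_addl.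
have ek : zero_ext f k = f (Ordinal kd') by rewrite -(zero_extE f (Ordinal kd')).
have [m /asboolP[c fm]] := fnil (Ordinal kd').
apply: (kexact_of_regular_quot (P0 k) (@PZD k) (f := zero_ext f k) (m := m) (c := c)).
- move=> x; rewrite ek /P; have := freg (Ordinal kd') x => /=.
  have -> : (fun j0 : 'I_k => f (widen_ord (ltnW (ltn_ord (Ordinal kd'))) j0)) =
            (fun j0 : 'I_k => zero_ext f j0).
    by apply/funext => l; rewrite -zero_extE.
  by [].
- by rewrite ek fm; apply: eq_bigr => l _; rewrite zero_extE.
have -> : (fun x => exists u, P k (x - zero_ext f k *: u)) = P k.+1.
  apply/funext => x; apply/propext; split.
    case=> u /asboolP[e xE]; apply/asboolP.
    exists (fun l => if unlift ord_max l is Some l' then e l' else u).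
    rewrite big_ord_recr /= unlift_none -[LHS](subrK (zero_ext f k *: u)) xE mulrC.
    congr (_ + _); apply: eq_bigr => l _.
    suff -> : widen_ord (leqnSn k) l = lift ord_max l by rewrite liftK.
    by apply: val_inj; rewrite /= /bump leqNgt ltn_ord.
  move=> /asboolP[e ->]; exists (e ord_max); rewrite big_ord_recr /= [e _ * _]mulrC addrK.
  by apply/asboolP; exists (fun l => e (widen_ord (leqnSn k) l)).
by apply: IHj => //; rewrite -jk addnS.
Qed.

End RegularExact.

(** * Freeness over the polynomial ring *)

Section PolyEval.
Variables (K : fieldType) (A : comAlgType K) (d : nat) (theta : 'I_d -> A).
Local Notation S := {mpoly K[d]}.

(** The action of S on A, X_i acting as theta_i. *)
Definition peval (p : S) : A := mmap (in_alg A) theta p.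
HB.instance Definition _ := GRing.RMorphism.copy peval (mmap (in_alg A) theta).

Lemma pevalX i : peval 'X_i = theta i.
Proof. by rewrite /peval mmapX mmap1U. Qed.

Lemma pevalC c : peval c%:MP = c%:A.
Proof. by rewrite /peval mmapC. Qed.

Lemma pevalZ c p : peval (c *: p) = c *: peval p.
Proof. by rewrite /peval mmapZ /= mulr_algl. Qed.

Variables (n : nat) (b : 'I_n -> A).

(** The S-linear map from the free module S^n to A given by the family b. *)
Definition free_eval (g : 'rV[S]_n) : A := \sum_k peval (g 0 k) * b k.

Lemma free_eval_additive : additive free_eval.
Proof.
move=> g h; rewrite /free_eval -sumrB; apply: eq_bigr => k _.
by rewrite !mxE raddfB mulrBl.
Qed.
HB.instance Definition _ :=
  GRing.isZmodMorphism.Build 'rV[S]_n A free_eval free_eval_additive.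

Lemma free_evalZ p g : free_eval (p *: g) = peval p * free_eval g.
Proof.
rewrite /free_eval mulr_sumr; apply: eq_bigr => k _.
by rewrite mxE rmorphM /= mulrA.
Qed.

End PolyEval.

Lemma mnm_sub1K d (m : 'X_{1..d}) i : m i != 0%N -> (U_(i) + (m - U_(i)))%MM = m.
Proof.
move=> mi; rewrite addmC submK //.
by apply/mnm_lepP => j; rewrite mnm1E; case: eqP => // <-; rewrite lt0n.
Qed.

Lemma mpoly_split (K : fieldType) d (p : {mpoly K[d]}) :
  exists c (h : 'I_d -> {mpoly K[d]}), p = c%:MP + \sum_i 'X_i * h i.
Proof.
elim/mpolyind: p => [|c m p _ _ [c' [h ->]]].
  by exists 0, (fun=> 0); rewrite mpolyC0 add0r big1 // => i _; rewrite mulr0.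
have [->|m0] := eqVneq m 0%MM.
  exists (c + c'), h; rewrite mpolyX0 addrA mpolyCD; congr (_ + _ + _).
  by rewrite -mul_mpolyC mulr1.
have [i mi] : exists i, m i != 0%N.
  apply/existsP; apply: contraR m0; rewrite negb_exists => /forallP mi.
  by apply/eqP/mnmP => i; rewrite mnm0E; apply/eqP; rewrite -[_ == _]negbK.
exists c', (fun j => h j + (if j == i then c *: 'X_[m - U_(i)] else 0)).
under [in RHS]eq_bigr => j _ do rewrite mulrDr.
rewrite big_split /= [RHS]addrA [RHS]addrC; congr (_ + _).
rewrite (bigD1 i) //= eqxx big1 ?addr0; last by move=> j /negbTE ->; rewrite mulr0.
by rewrite -scalerAr -mpolyXD mnm_sub1K.
Qed.

Lemma mcoeffXM (K : fieldType) d (p : {mpoly K[d]}) i m :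
  ('X_i * p)@_m = if m i is 0 then 0 else p@_(m - U_(i)).
Proof.
rewrite mulrC; case mi: (m i) => [|k].
  elim/mpolyind: p => [|c m' p _ _ IH]; first by rewrite mul0r mcoeff0.
  rewrite mulrDl mcoeffD IH addr0 -scalerAl mcoeffZ -mpolyXD mcoeffX.
  case: eqP => [E|_]; last by rewrite mulr0.
  by move: mi; rewrite -E mnmDE mnm1E eqxx addn1.
by rewrite -{1}(mnm_sub1K (m := m) (i := i)) ?mi // mcoeffMX.
Qed.

Section Freeness.
Variables (K : fieldType) (A : gradedAlgType K) (d : nat) (theta : 'I_d -> A).
Variables (n : nat) (b : 'I_n -> A).
Local Notation S := {mpoly K[d]}.
Local Notation Phi := (free_eval theta b).

Hypothesis theta_exact : @kexact A A^o (zero_ext theta) (fun x => x = 0) d 1.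
Hypothesis b_span : forall x, exists g, Phi g = x.
Hypothesis b_free : forall c : 'I_n -> K,
  \sum_k c k *: b k \in gen_ideal theta -> forall k, c k = 0.

(** Let g be in the kernel. Its constant terms vanish since b is independent
    modulo theta, so g is the boundary of a Koszul 1-chain z with coefficients
    in S^n. The image of z in A is a cycle, hence a boundary; subtracting from
    z the boundary of a lift leaves a chain with coefficients in the kernel
    and the same boundary g. So the kernel is S_+ times itself, and an
    element of it has no terms of degree below j, for every j. *)
Lemma free_eval_injective g : Phi g = 0 -> g = 0.
Proof.
pose psi : {additive 'rV[S]_n -> A^o} := Phi.
have phiZ i (v : 'rV[S]_n) : psi (zero_ext (fun j => 'X_j) i *: v) =
    zero_ext theta i *: psi v.
  rewrite /psi /= free_evalZ; congr (_ * _); rewrite /zero_ext; case: insubP => [j _ _|_] /=.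
    exact: pevalX.
  exact: raddf0.
(* Relations have no constant terms. *)
have split0 h : Phi h = 0 ->
    exists y : nat -> 'rV[S]_n, h = \sum_(i < d) 'X_i *: y i.
  move=> h0; have /choice[c /choice[u hE]] := fun k => mpoly_split (h 0 k).
  have c0 : forall k, c k = 0.
    apply: b_free; apply/asboolP.
    exists (fun i => - \sum_k peval theta (u k i) * b k).
    apply/eqP; rewrite -subr_eq0; apply/eqP; rewrite -[RHS]h0 /free_eval.
    under [RHS]eq_bigr => k _ do
      rewrite hE raddfD /= pevalC mulrDl mulr_algl raddf_sum /= mulr_suml.
    rewrite big_split /=; congr (_ + _); rewrite -sumrN exchange_big /=.
    apply: eq_bigr => i _; rewrite mulNr opprK mulr_suml; apply: eq_bigr => k _.
    by rewrite rmorphM /= pevalX -mulrA mulrC.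
  exists (zero_ext (fun i => \row_k u k i)); apply/rowP => k.
  rewrite summxE hE c0 mpolyC0 add0r; apply: eq_bigr => i _.
  by rewrite zero_extE !mxE.
(* The coefficients can be taken in the kernel again. *)
have split h : Phi h = 0 -> exists y : nat -> 'rV[S]_n,
    (forall i, Phi (y i) = 0) /\ h = \sum_(i < d) 'X_i *: y i.
  move=> h0; have [y yE] := split0 h h0.
  pose t := zero_ext (fun j : 'I_d => 'X_j : S).
  have [z z1 zE] := kcst_kd_deg1 t d y.
  have {}zE : kd t z = kcst d h.
    by rewrite zE yE; congr (kcst _ _); apply: eq_bigr => i _; rewrite /t zero_extE.
  have [|w w2 /kall_eq0 /subr0_eq wE] := theta_exact (kmap_kdeg psi z1).
    by apply/kall_eq0; rewrite -(kmap_kd phiZ) zE kmap_kcst (h0 : psi h = 0) raddf0.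
  have [W W2 WE] := kmap_lift (phi := psi) b_span w2.
  have z'1 : kdeg 1 (z - kd t W) by apply: kdegB => //; exact: kdeg_kd.
  have z'0 : kall (fun v => psi v = 0) (z - kd t W).
    by apply: kmap_ker; rewrite raddfB /= (kmap_kd phiZ) WE wE subrr.
  have [x [x0 xE]] := kd_deg1_kcst (P := fun v => psi v = 0) t (raddf0 psi) z'1 z'0.
  exists x; split=> //; apply: (@kcst_inj _ _ d).
  rewrite -zE -[LHS]subr0 -(kd_kd t W) -linearB /= xE; congr (kcst _ _).
  by apply: eq_bigr => i _; rewrite /t zero_extE.
suff H j : forall h, Phi h = 0 -> forall k m, (mdeg m < j)%N -> (h 0 k)@_m = 0.
  by move=> g0; apply/rowP => k; apply/mpolyP => m; rewrite mxE mcoeff0 (H (mdeg m).+1).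
elim: j => [|j IHj] h h0 k m // mj.
have [y [y0 ->]] := split h h0.
rewrite summxE raddf_sum big1 // => i _ /=; rewrite mxE mcoeffXM.
case mi: (m i) => [//|l]; apply: IHj => //.
have : mdeg (U_(i) + (m - U_(i)))%MM = mdeg m by rewrite mnm_sub1K ?mi.
by rewrite mdegD mdeg1 => E; rewrite -ltnS -E add1n in mj.
Qed.

End Freeness.

(** * The strong Lefschetz property of a monomial complete intersection *)

Section Lefschetz.
Variables (K : fieldType) (d r : nat).
Hypotheses (K_char0 : [pchar K] =i pred0) (r_gt0 : (0 < r)%N).
Local Notation S := {mpoly K[d]}.
Local Notation N := (d * r.-1)%N.

(** Membership in the ideal generated by the X_i^r, read off the coefficients. *)
Definition box_free (p : S) : Prop :=
  forall m : 'X_{1..d}, (forall i, m i < r)%N -> p@_m = 0.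

Lemma box_free0 : box_free 0.
Proof. by move=> m _; rewrite mcoeff0. Qed.

Lemma box_freeD p q : box_free p -> box_free q -> box_free (p + q).
Proof. by move=> hp hq m hm; rewrite mcoeffD hp ?hq ?addr0. Qed.

Lemma box_freeZ c p : box_free p -> box_free (c *: p).
Proof. by move=> hp m hm; rewrite mcoeffZ hp ?mulr0. Qed.

Lemma box_freeN p : box_free p -> box_free (- p).
Proof. by rewrite -scaleN1r; exact: box_freeZ. Qed.

Lemma box_freeB p q : box_free p -> box_free q -> box_free (p - q).
Proof. by move=> hp hq; apply: box_freeD => //; exact: box_freeN. Qed.

Lemma mcoeffXnM (p : S) (i : 'I_d) e (m : 'X_{1..d}) :
  (m i < e)%N -> ('X_i ^+ e * p)@_m = 0.
Proof.
elim: e m => [//|e IHe] m me; rewrite exprS -mulrA mcoeffXM.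
case mi: (m i) => [//|k]; apply: IHe.
by rewrite mnmBE mnm1E eqxx mi subn1 -ltnS -mi.
Qed.

Lemma box_free_gen (u : 'I_d -> S) : box_free (\sum_i 'X_i ^+ r * u i).
Proof.
by move=> m hm; rewrite raddf_sum big1 // => i _; exact: mcoeffXnM.
Qed.

Lemma box_freeP (p : S) : box_free p <-> exists u, p = \sum_i 'X_i ^+ r * u i.
Proof.
split; last by case=> u ->; exact: box_free_gen.
move=> hp; rewrite [p]mpolyE big_seq.
apply: (big_ind (fun q : S => exists u, q = \sum_i 'X_i ^+ r * u i)).
- by exists (fun=> 0); rewrite big1 // => i _; rewrite mulr0.
- move=> _ _ [u ->] [v ->]; exists (fun i => u i + v i).
  by rewrite -big_split; apply: eq_bigr => i _; rewrite mulrDr.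
move=> m mp; have [i mi] : exists i, (r <= m i)%N.
  apply/existsP; apply: contraLR mp; rewrite negb_exists => /forallP mi.
  by rewrite mcoeff_msupp negbK hp // => i; rewrite ltnNge.
exists (fun j => if j == i then p@_m *: 'X_[m - U_(i) *+ r] else 0).
rewrite (bigD1 i) //= eqxx big1 ?addr0; last by move=> j /negbTE ->; rewrite mulr0.
rewrite -scalerAr mpolyXn -mpolyXD addmC submK //.
by apply/mnm_lepP => j; rewrite mulmnE mnm1E; case: eqP => [<-|_]; rewrite ?mul1n.
Qed.

Lemma box_freeM q p : box_free p -> box_free (q * p).
Proof.
move=> /box_freeP[u ->]; apply/box_freeP; exists (fun i => q * u i).
by rewrite mulr_sumr; apply: eq_bigr => i _; rewrite mulrCA.
Qed.

Lemma box_free_large e (p : S) : p \is e.-homog for mdeg -> (N < e)%N -> box_free p.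
Proof.
move=> hp Na m hm; apply: (dhomog_nemf_coeff hp); rewrite neq_ltn.
apply/orP; left; apply: leq_ltn_trans Na; rewrite /= mdegE.
apply: (@leq_trans (\sum_(i < d) r.-1)%N); last by rewrite sum_nat_const card_ord.
by apply: leq_sum => i _; rewrite -ltnS prednK.
Qed.

Definition lform : S := \sum_i 'X_i.
(** The lowering operator of an sl_2-action whose raising operator is
    multiplication by lform. It maps X^a to the sum of the
    a_i (r - a_i) X^(a - e_i). *)
Definition lower (p : S) : S :=
  \sum_i ((r.-1)%:R *: p^`M(i) - 'X_i * (p^`M(i))^`M(i)).

Lemma lform_homog : lform \is 1.-homog for mdeg.
Proof. by apply: rpred_sum => i _; rewrite dhomogX /= mdeg1. Qed.

Lemma lformX_homog k e (p : S) : p \is e.-homog for mdeg ->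
  lform ^+ k * p \is (k + e).-homog for mdeg.
Proof.
move=> hp; elim: k => [|k IHk]; first by rewrite expr0 mul1r.
rewrite exprS -mulrA addSn -add1n; exact: dhomogM lform_homog IHk.
Qed.

Lemma lower_linear : linear lower.
Proof.
move=> c p q; rewrite /lower scaler_sumr -big_split; apply: eq_bigr => i _ /=.
rewrite !mderivD !mderivZ mulrDr -scalerAr scalerDr !scalerA [_ * c]mulrC.
by rewrite -scalerA scalerBr opprD addrACA.
Qed.
HB.instance Definition _ := GRing.isLinear.Build K S S _ lower lower_linear.

Lemma deriv_homog e i (p : S) : p \is e.+1.-homog for mdeg ->
  p^`M(i) \is e.-homog for mdeg.
Proof.
move=> hp; apply/dhomogP => m; rewrite mcoeff_msupp mcoeff_deriv => hm.
apply/eqP; apply: contraNT hm => hm.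
rewrite (dhomog_nemf_coeff hp) ?mul0rn //= mdegD mdeg1 addn1 eqSS.
exact: hm.
Qed.

Lemma deriv_homog0 i (p : S) : p \is 0.-homog for mdeg -> p^`M(i) = 0.
Proof.
move=> hp; apply/mpolyP => m; rewrite mcoeff_deriv mcoeff0.
by rewrite (dhomog_nemf_coeff hp) ?mul0rn //= mdegD mdeg1 addn1.
Qed.

Lemma lower_homog e (p : S) : p \is e.+1.-homog for mdeg -> lower p \is e.-homog for mdeg.
Proof.
move=> hp; apply: rpred_sum => i _; have hi := deriv_homog i hp.
apply: rpredB; first exact: rpredZ.
case: e hp hi => [|e] hp hi; first by rewrite deriv_homog0 // mulr0 rpred0.
rewrite -add1n; apply: dhomogM; last exact: deriv_homog.
by rewrite dhomogX /= mdeg1.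
Qed.

Lemma lower_homog0 p : p \is 0.-homog for mdeg -> lower p = 0.
Proof.
move=> hp; rewrite /lower big1 // => i _.
by rewrite deriv_homog0 // mderiv0 mulr0 scaler0 subr0.
Qed.

Lemma lform_lower_homog e (p : S) : p \is e.-homog for mdeg ->
  lform * lower p \is e.-homog for mdeg.
Proof.
case: e => [|e] hp; first by rewrite lower_homog0 // mulr0 rpred0.
rewrite -add1n; exact: dhomogM lform_homog (lower_homog hp).
Qed.

Lemma mcoeffX_deriv (p : S) (i : 'I_d) (m : 'X_{1..d}) :
  ('X_i * p^`M(i))@_m = p@_m *+ m i.
Proof.
rewrite mcoeffXM; case mi: (m i) => [|k]; first by rewrite mulr0n.
rewrite mcoeff_deriv mnmBE mnm1E eqxx mi subn1 /=; congr (_@__ *+ _).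
by rewrite addmC mnm_sub1K ?mi.
Qed.

(** A term could leave the ideal only by lowering an exponent a_i = r, and then
    its coefficient a_i (r - a_i) is zero. *)
Lemma box_free_lower p : box_free p -> box_free (lower p).
Proof.
move=> hp m hm; rewrite raddf_sum big1 // => i _ /=.
rewrite mcoeffB mcoeffZ mcoeffX_deriv mcoeff_deriv.
have [mi|mi] := ltnP (m i).+1 r.
  rewrite hp ?mul0rn ?mulr0 ?subr0 // => j; rewrite mnmDE mnm1E.
  by case: eqP => [<-|_]; rewrite ?addn1 ?addn0.
have -> : r.-1 = m i by have := hm i; lia.
by rewrite mulr_natl subrr.
Qed.

Lemma euler e (p : S) : p \is e.-homog for mdeg -> \sum_i 'X_i * p^`M(i) = p *+ e.
Proof.
move=> hp; apply/mpolyP => m; rewrite raddf_sum mcoeffMn /=.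
under eq_bigr do rewrite mcoeffX_deriv.
rewrite sumrMnr -mdegE; have [->//|ne] := eqVneq (mdeg m) e.
by rewrite (dhomog_nemf_coeff hp ne) !mul0rn.
Qed.

(** The commutation relation of sl_2. By Leibniz the difference of the two sides
    is d (r - 1) p - 2 (sum of X_i dp/dX_i), and the Euler formula evaluates
    the last sum. *)
Lemma lower_lform e (p : S) : p \is e.-homog for mdeg ->
  lower (lform * p) = lform * lower p + (N%:R - (2 * e)%:R) *: p.
Proof.
move=> hp; have dl i : lform^`M(i) = 1.
  rewrite /lform raddf_sum /= (bigD1 i) //= big1 => [|j ji].
    rewrite addr0 mderivX mnm1E eqxx scale1r.
    suff -> : (U_(i) - U_(i))%MM = 0%MM :> 'X_{1..d} by rewrite mpolyX0.
    by apply/mnmP => j; rewrite mnmBE subnn mnm0E.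
  by rewrite mderivX mnm1E (negbTE ji) scale0r.
rewrite /lower mulr_sumr scalerBl.
have -> : (2 * e)%:R *: p = \sum_i ('X_i * p^`M(i)) *+ 2.
  by rewrite sumrMnl (euler hp) -mulrnA scaler_nat mulnC.
have -> : N%:R *: p = \sum_(i < d) (r.-1)%:R *: p.
  by rewrite sumr_const card_ord -scaler_nat scalerA -natrM.
rewrite -sumrB -big_split; apply: eq_bigr => i _ /=.
rewrite !mderivM dl mul1r mderivD mderivM dl mul1r.
rewrite -!mul_mpolyC; ring.
Qed.

Lemma lower_lformX k e (p : S) : p \is e.-homog for mdeg ->
  lower (lform ^+ k.+1 * p) = lform ^+ k.+1 * lower p +
    ((k.+1)%:R * (N%:R - (2 * e + k)%:R)) *: (lform ^+ k * p).
Proof.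
move=> hp; elim: k => [|k IHk].
  by rewrite expr1 expr0 mul1r mul1r addn0 (lower_lform hp).
rewrite exprS -mulrA (lower_lform (lformX_homog k.+1 hp)) IHk mulrDr -scalerAr.
rewrite !mulrA -!exprS -addrA -scalerDl; congr (_ + _ *: _).
by ring.
Qed.

Lemma char0_natS_neq0 n : (n.+1)%:R != 0 :> K.
Proof. by move: K_char0 => /pcharf0P ->. Qed.

Lemma box_free_Zinv c p : c != 0 -> box_free (c *: p) -> box_free p.
Proof. by move=> c0 h; rewrite -[p]scale1r -(mulVf c0) -scalerA; exact: box_freeZ. Qed.

(** Write Q for the ideal of the X_i^r and l for lform. If l^(k+1) p is in Q,
    lowering it gives l^(k+1) (lower p) + c l^k p in Q with c nonzero in the
    given range. Multiplying by l shows that l^(k+2) (lower p) is in Q, so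
    lower p is in Q by induction on the degree. Then l^k p is in Q, and
    induction on k concludes. *)
Lemma lefschetz_inj e k (p : S) : p \is e.-homog for mdeg -> (2 * e + k <= N)%N ->
  box_free (lform ^+ k * p) -> box_free p.
Proof.
(* One descent from l^(k+1) to l^k, given the claim for lower q. *)
have step e' k' q : q \is e'.-homog for mdeg -> (2 * e' + k'.+1 <= N)%N ->
    box_free (lform ^+ k'.+1 * q) ->
    (box_free (lform ^+ k'.+2 * lower q) -> box_free (lower q)) ->
    box_free (lform ^+ k' * q).
  move=> hq kN hk lowq.
  have := box_free_lower hk; rewrite (lower_lformX k' hq).
  set c := _%:R * _ => hl.
  have c0 : c != 0.
    rewrite /c -natrB; last by lia.
    have -> : (N - (2 * e' + k') = (N - (2 * e' + k')).-1.+1)%N by lia.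
    by rewrite mulf_neq0 // char0_natS_neq0.
  have {}lowq : box_free (lower q).
    apply: lowq; rewrite exprS -mulrA.
    have := box_freeB (box_freeM lform hl) (box_freeZ c hk).
    by rewrite mulrDr -scalerAr [lform * (lform ^+ k' * q)]mulrA -exprS addrK.
  apply: (box_free_Zinv c0).
  by have := box_freeB hl (box_freeM (lform ^+ k'.+1) lowq); rewrite addrC addKr.
elim: e k p => [|e IHa] k p hp; elim: k => [|k IHk] kN hk;
  try by rewrite expr0 mul1r in hk.
- apply: IHk; first by lia.
  apply: (step _ _ _ hp) => // _.
  by rewrite lower_homog0 //; exact: box_free0.
- apply: IHk; first by lia.
  apply: (step _ _ _ hp) => //.
  by apply: IHa; [exact: lower_homog|lia].
Qed.

(** The dual argument, by induction from high degrees downwards and on k. Modulo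
    the ideal, p = l^k u and l p = l^(k+2) z by induction, so l^(k+1) u and
    l^(k+2) z agree. Lowering both yields c l^k u in l^(k+1) S with c nonzero.
    The clause on u makes up for the truncation of b - k. *)
Lemma lefschetz_surj b k (p : S) : p \is b.-homog for mdeg -> (k + N <= 2 * b)%N ->
  exists u, [/\ u \is (b - k).-homog for mdeg, (b < k)%N -> u = 0 &
    box_free (p - lform ^+ k * u)].
Proof.
have [s] := ubnP (N.+1 - b); elim: s b k p => // s IHs b k p bs.
(* Past the top degree N everything lies in the ideal. *)
have [Nb|bN] := ltnP N b.
  move=> hp _; exists 0; split=> //; first exact: rpred0.
  by rewrite mulr0 subr0; exact: box_free_large hp Nb.
elim: k p => [|k IHk] p hp kN.
  exists p; rewrite subn0; split=> //.
  by rewrite expr0 mul1r subrr; exact: box_free0.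
have [|u [hu _ hpu]] := IHk p hp _; first by lia.
have [|||z [hz _ hpz]] := IHs b.+1 k.+2 (lform * p).
- by lia.
- by rewrite -add1n; exact: dhomogM lform_homog hp.
- by lia.
have ebk : (b - k = (b - k.+1).+1)%N by lia.
have hz' : z \is (b - k.+1).-homog for mdeg by rewrite subSS in hz.
pose c : K := k.+1%:R * (N%:R - (2 * (b - k) + k)%:R).
pose c' : K := k.+2%:R * (N%:R - (2 * (b - k.+1) + k.+1)%:R).
have c0 : c != 0.
  rewrite /c -opprB -natrB; last by lia.
  have -> : (2 * (b - k) + k - N = (2 * (b - k) + k - N).-1.+1)%N by lia.
  by rewrite mulf_neq0 // ?oppr_eq0 char0_natS_neq0.
exists (c^-1 *: (lform * lower z + c' *: z - lower u)); split=> //.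
- apply: rpredZ; apply: rpredB; last by rewrite ebk in hu; exact: lower_homog.
  by apply: rpredD; [exact: lform_lower_homog|exact: rpredZ].
- by lia.
have E1 : box_free (lower (lform ^+ k.+1 * u - lform ^+ k.+2 * z)).
  apply: box_free_lower.
  have := box_freeB hpz (box_freeM lform hpu).
  by congr box_free; rewrite !exprS; ring.
rewrite linearB /= (lower_lformX k hu) (lower_lformX k.+1 hz') -/c -/c' in E1.
have := box_freeD hpu (box_freeZ c^-1 E1).
congr box_free; rewrite scalerBr scalerDr scalerA mulVf // scale1r -!mul_mpolyC.
by rewrite !exprS; ring.
Qed.

End Lefschetz.

(** * Homogeneous components *)

Section Components.
Variables (K : fieldType) (A : gradedAlgType K).

Lemma hcomp_ex (x : A) : exists y : nat -> A, (forall i, y i \in hpart i) /\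
  exists n, (forall i, (n <= i)%N -> y i = 0) /\
    forall N, (n <= N)%N -> x = \sum_(i < N) y i.
Proof.
have [n [y [yh y0 yE]]] := sum_predP (@hpart_submod K A) (hpart_sum x).
by exists y; split=> //; exists n.
Qed.

Definition hcomp (x : A) : nat -> A := sval (cid (hcomp_ex x)).

Lemma hcomp_hpart x i : hcomp x i \in hpart i.
Proof. have [h _] := svalP (cid (hcomp_ex x)); exact: h. Qed.

Lemma hcompE x : exists n, (forall i, (n <= i)%N -> hcomp x i = 0) /\
  forall N, (n <= N)%N -> x = \sum_(i < N) hcomp x i.
Proof. have [_ h] := svalP (cid (hcomp_ex x)); exact: h. Qed.

Lemma hcomp_uniq x n (y : nat -> A) : (forall i, y i \in hpart i) ->
  (forall i, (n <= i)%N -> y i = 0) -> x = \sum_(i < n) y i -> hcomp x =1 y.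
Proof.
move=> yh y0 xE i; have [m [x0 xS]] := hcompE x.
pose N := maxn (maxn n m) i.+1.
have nN : (n <= N)%N by exact: leq_trans (leq_maxl n m) (leq_maxl _ _).
have mN : (m <= N)%N by exact: leq_trans (leq_maxr n m) (leq_maxl _ _).
have iN : (i < N)%N by exact: leq_maxr.
pose z j := -1 *: y j + hcomp x j.
have zh j : z j \in hpart j by apply: hpartD; [exact: hpartZ|exact: hcomp_hpart].
have z0 : \sum_(j < N) z j = 0.
  rewrite big_split -scaler_sumr /= -(xS _ mN) scaleN1r.
  suff -> : \sum_(j < N) y j = x by rewrite addNr.
  rewrite xE (big_ord_widen N y nN) [RHS]big_mkcond /=.
  by apply: eq_bigr => j _; case: ltnP => // /y0.
by have /eqP := hpart_direct zh z0 iN; rewrite /z scaleN1r addrC subr_eq0 => /eqP.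
Qed.

Lemma hcomp_linear a x y i : hcomp (a *: x + y) i = a *: hcomp x i + hcomp y i.
Proof.
have [n [x0 xE]] := hcompE x; have [m [y0 yE]] := hcompE y.
apply: (hcomp_uniq (n := maxn n m) (y := fun i => a *: hcomp x i + hcomp y i)).
- by move=> j; apply: hpartD; [apply: hpartZ|]; exact: hcomp_hpart.
- by move=> j; rewrite geq_max => /andP[/x0 -> /y0 ->]; rewrite scaler0 addr0.
- rewrite big_split -scaler_sumr /= -xE ?leq_maxl // -yE ?leq_maxr //.
Qed.

Definition hproj i x := hcomp x i.
HB.instance Definition _ i := GRing.isLinear.Build K A A _ (hproj i)
  (fun a x y => hcomp_linear a x y i).

Lemma hcomp_sum (I : Type) (s : seq I) (P : pred I) (F : I -> A) i :
  hcomp (\sum_(j <- s | P j) F j) i = \sum_(j <- s | P j) hcomp (F j) i.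
Proof. exact: (raddf_sum (hproj i)). Qed.

Lemma hcompZ a x i : hcomp (a *: x) i = a *: hcomp x i.
Proof. exact: (linearZZ (hproj i)). Qed.

Lemma hcompB x y i : hcomp (x - y) i = hcomp x i - hcomp y i.
Proof. exact: (raddfB (hproj i)). Qed.

Lemma hcompM e x y i : y \in hpart e ->
  hcomp (x * y) i = if (e <= i)%N then hcomp x (i - e) * y else 0.
Proof.
move=> ye; have [n [x0 xE]] := hcompE x.
apply: (hcomp_uniq (n := (e + n)%N)
  (y := fun i => if (e <= i)%N then hcomp x (i - e) * y else 0)).
- move=> j; case: leqP => [ej|_]; last exact: hpart0.
  by rewrite -{2}(subnK ej); apply: hpartM => //; exact: hcomp_hpart.
- move=> j ej; case: leqP => // _; rewrite x0 ?mul0r //; lia.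
- rewrite big_split_ord /= big1 ?add0r => [|j _]; last by rewrite leqNgt ltn_ord.
  rewrite {1}(xE n) // mulr_suml; apply: eq_bigr => j _.
  by rewrite leq_addr addKn.
Qed.

Lemma hcomp_id e x i : x \in hpart e -> hcomp x i = if i == e then x else 0.
Proof.
move=> xe; rewrite -[x in LHS]mul1r (hcompM _ _ xe).
have h1 j : hcomp 1 j = if j == 0%N then 1 else 0 :> A.
  apply: (hcomp_uniq (n := 1) (y := fun j => if j == 0%N then 1 else 0)).
  - by move=> k; case: eqP => [->|_]; [exact: hpart1|exact: hpart0].
  - by case.
  - by rewrite big_ord1.
rewrite h1; case: (ltngtP i e) => // h; last by rewrite h subnn eqxx mul1r.
by rewrite subn_eq0 leqNgt h mul0r.
Qed.

End Components.

(** * Homogeneous generators over the polynomial ring *)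

Section LinearForms.
Variables (K : fieldType) (A : gradedAlgType K) (d : nat) (theta : 'I_d -> A).
Hypothesis theta1 : forall i, theta i \in hpart 1.
Local Notation I := (gen_ideal theta).
Local Notation S := {mpoly K[d]}.

Lemma hcomp_ideal x i : x \in I -> hcomp x i \in I.
Proof.
move=> /asboolP[c ->]; rewrite hcomp_sum; apply/asboolP.
exists (fun j => if (1 <= i)%N then hcomp (c j) (i - 1) else 0).
by apply: eq_bigr => j _; rewrite (hcompM _ _ (theta1 j)); case: ifP; rewrite ?mul0r.
Qed.

Definition spans_mod n (b : 'I_n -> A) :=
  forall x, exists c : 'I_n -> K, x - \sum_k c k *: b k \in I.

Lemma homog_spans n0 (x0 : 'I_n0 -> A) : spans_mod x0 ->
  exists n (b : 'I_n -> A) (delta : 'I_n -> nat),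
    (forall k, b k \in hpart (delta k)) /\ spans_mod b.
Proof.
move=> sp; have /choice[e eP] := fun j => hcompE (x0 j).
pose M := \max_j e j.
pose T := ('I_M * 'I_n0)%type.
pose u (k : 'I_#|{: T}|) : T := enum_val k.
exists #|{: T}|, (fun k => hcomp (x0 (u k).2) (u k).1), (fun k => (u k).1).
split=> [k|x]; first exact: hcomp_hpart.
have [c cP] := sp x; exists (fun k => c (u k).2).
suff -> : \sum_k c (u k).2 *: hcomp (x0 (u k).2) (u k).1 = \sum_k c k *: x0 k by [].
rewrite -(big_enum_val (A := {: T}) (fun v : T => c v.2 *: hcomp (x0 v.2) v.1)) /=.
rewrite -(pair_bigA _ (fun (i : 'I_M) j => c j *: hcomp (x0 j) i)) exchange_big /=.
apply: eq_bigr => j _; rewrite -scaler_sumr; congr (_ *: _).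
by case: (eP j) => _ <- //; exact: leq_bigmax.
Qed.

(** A homogeneous spanning family of least size is independent: an element that
    occurs in a relation could be dropped. *)
Lemma homog_basis n0 (x0 : 'I_n0 -> A) : spans_mod x0 ->
  exists n (b : 'I_n -> A) (delta : 'I_n -> nat),
    [/\ forall k, b k \in hpart (delta k), spans_mod b
      & forall c : 'I_n -> K, \sum_k c k *: b k \in I -> forall k, c k = 0].
Proof.
move=> /homog_spans H.
pose P n := `[< exists (b : 'I_n -> A) (delta : 'I_n -> nat),
    (forall k, b k \in hpart (delta k)) /\ spans_mod b >].
have exP : exists n, P n.
  by have [n [b [delta h]]] := H; exists n; apply/asboolP; exists b, delta.
case: (ex_minnP exP) => n /asboolP[b [delta [bh bs]]] nmin.
exists n, b, delta; split=> // c cI k0; apply/eqP; apply: contraT => ck0.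
case: n b delta bh bs nmin c cI k0 ck0 => [|n] b delta bh bs nmin c cI k0 ck0.
  by case: k0 ck0.
(* Solving the relation for b k0 makes that element superfluous. *)
suff /nmin : P n by rewrite ltnn.
apply/asboolP; exists (fun k => b (lift k0 k)), (fun k => delta (lift k0 k)).
split=> // x.
have [c' xE] := bs x.
exists (fun k => c' (lift k0 k) - c' k0 / c k0 * c (lift k0 k)).
apply: (gen_ideal_eq _ (gen_idealD xE (gen_idealZ (c' k0 / c k0) cI))).
rewrite !(bigD1_ord k0) //= scalerDr scalerA divfK // opprD -addrA; congr (_ + _).
rewrite scaler_sumr -sumrN addrACA addNr add0r -big_split -sumrN /=.
by apply: eq_bigr => k _; rewrite scalerBl opprB scalerA addrC.
Qed.

Variables (n : nat) (b : 'I_n -> A) (delta : 'I_n -> nat).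
Hypotheses (b_hom : forall k, b k \in hpart (delta k)) (b_spans : spans_mod b).

Lemma hpart_split m x : x \in hpart m ->
  exists c : 'I_n -> K, x - \sum_(k | delta k == m) c k *: b k \in I.
Proof.
move=> xm; have [c xE] := b_spans x; exists c.
have := hcomp_ideal m xE; rewrite hcompB (hcomp_id _ xm) eqxx hcomp_sum.
apply: gen_ideal_eq; congr (_ - _); rewrite [RHS]big_mkcond /=; apply: eq_bigr => k _.
by rewrite hcompZ (hcomp_id _ (b_hom k)) eq_sym; case: eqP => // _; rewrite scaler0.
Qed.

(** The degree m part of the free module whose k-th generator has degree delta_k;
    the second clause makes up for the truncation of m - delta_k. *)
Definition hom_row m (g : 'rV[S]_n) := forall k,
  g 0 k \is (m - delta k).-homog for mdeg /\ ((m < delta k)%N -> g 0 k = 0).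

Lemma hom_row_const m (c : 'I_n -> K) :
  exists2 g, hom_row m g & free_eval theta b g = \sum_(k | delta k == m) c k *: b k.
Proof.
exists (\row_k (if delta k == m then (c k)%:MP else 0)).
  move=> k; rewrite mxE; case: eqP => [->|_]; last by rewrite rpred0.
  rewrite subnn ltnn; split=> //.
  by rewrite -[_%:MP]mulr1 mul_mpolyC; apply: rpredZ; exact: dhomog1.
rewrite /free_eval [RHS]big_mkcond; apply: eq_bigr => k _; rewrite mxE.
by case: ifP => _; [rewrite pevalC mulr_algl|rewrite raddf0 mul0r].
Qed.

Lemma hom_rowD m g h : hom_row m g -> hom_row m h -> hom_row m (g + h).
Proof.
move=> hg hh k; rewrite mxE; have [g1 g2] := hg k; have [h1 h2] := hh k.
by split; [exact: rpredD|move=> mk; rewrite g2 // h2 // addr0].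
Qed.

Lemma hom_row0 m : hom_row m 0.
Proof. by move=> k; rewrite mxE rpred0. Qed.

Lemma hom_rowX m i g : hom_row m g -> hom_row m.+1 ('X_i *: g).
Proof.
move=> hg k; rewrite mxE; have [g1 g2] := hg k; split.
  have [mk|mk] := ltnP m (delta k); first by rewrite g2 // mulr0 rpred0.
  rewrite subSn // -(add1n (m - delta k)); apply: dhomogM => //.
  by rewrite dhomogX /= mdeg1.
by move=> mk; rewrite g2 ?mulr0 // ltnW.
Qed.

(** Graded Nakayama: modulo theta, x is a combination of the b_k, and the
    remainder has coefficients of degree one less. *)
Lemma hom_row_span m x : x \in hpart m ->
  exists2 g, hom_row m g & free_eval theta b g = x.
Proof.
elim: m x => [|m IHm] x xm; have [c yI] := hpart_split xm.
  have [g gh gE] := hom_row_const 0 c; exists g => //; rewrite gE.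
  have xc0 : x - \sum_(k | delta k == 0%N) c k *: b k \in hpart 0.
    rewrite -scaleN1r addrC; apply: hpartD => //; apply: hpartZ.
    by apply: hpart_sumr => k /eqP <-; exact: hpartZ.
  (* The ideal of theta has no nonzero elements of degree 0. *)
  have := hcomp_id 0 xc0; rewrite eqxx => xcE.
  apply/esym/eqP; rewrite -subr_eq0 -xcE; move: yI => /asboolP[y ->].
  by rewrite hcomp_sum big1 // => i _; rewrite (hcompM _ _ (theta1 i)).
have [g gh gE] := hom_row_const m.+1 c.
have xcm : x - \sum_(k | delta k == m.+1) c k *: b k \in hpart m.+1.
  rewrite -scaleN1r addrC; apply: hpartD => //; apply: hpartZ.
  by apply: hpart_sumr => k /eqP <-; exact: hpartZ.
have := hcomp_id m.+1 xcm; rewrite eqxx => xcE.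
move: yI => /asboolP[y yE].
have /choice[u uP] : forall i, exists u, hom_row m u /\
    free_eval theta b u = hcomp (y i) m.
  by move=> i; have [u] := IHm _ (hcomp_hpart (y i) m); exists u.
exists (g + \sum_i 'X_i *: u i).
  apply: hom_rowD => //; apply: (big_ind (hom_row m.+1)); first exact: hom_row0.
    by move=> h h'; exact: hom_rowD.
  by move=> i _; apply: hom_rowX; case: (uP i).
rewrite raddfD /= gE raddf_sum /= addrC; apply/esym/eqP; rewrite -subr_eq; apply/eqP.
rewrite -xcE yE hcomp_sum; apply: eq_bigr => i _.
rewrite free_evalZ pevalX (hcompM _ _ (theta1 i)) subn1 /= mulrC.
by case: (uP i) => _ ->.
Qed.

Lemma free_eval_span x : exists g, free_eval theta b g = x.
Proof.
have [N [_ /(_ N (leqnn N)) ->]] := hcompE x.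
apply: (big_ind (fun x => exists g, free_eval theta b g = x)).
- by exists 0; rewrite raddf0.
- by move=> _ _ [g <-] [h <-]; exists (g + h); rewrite raddfD.
- by move=> i _; have [g _ gE] := hom_row_span (hcomp_hpart x i); exists g.
Qed.

Lemma peval_hom m (p : S) : p \is m.-homog for mdeg -> peval theta p \in hpart m.
Proof.
move=> hp; rewrite [p]mpolyE raddf_sum /= big_seq; apply: hpart_sumr => mu mup.
rewrite pevalZ; apply: hpartZ; rewrite -(dhomog_mf hp mup) /=.
rewrite /peval mmapX /mmap1 mdegE.
apply: (big_ind2 (fun (x : A) j => x \in hpart j)); first exact: hpart1.
  by move=> x1 x2 y1 y2; exact: hpartM.
by move=> i _; rewrite -[X in hpart X]muln1; apply: hpartX; exact: theta1.
Qed.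

Lemma free_eval_hom m g : hom_row m g -> free_eval theta b g \in hpart m.
Proof.
move=> hg; apply: hpart_sumr => k _; have [gk gk0] := hg k.
have [mk|mk] := ltnP m (delta k); first by rewrite gk0 // raddf0 mul0r hpart0.
by rewrite -(subnK mk); apply: hpartM; [exact: peval_hom|exact: b_hom].
Qed.

Lemma hpart_large m x : (forall k, delta k < m)%N -> x \in hpart m -> x \in I.
Proof.
move=> mk xm; have [c] := hpart_split xm; rewrite big_pred0 ?subr0 // => k.
by rewrite ltn_eqF.
Qed.

(** The power f^e lives in degrees at least e, while A / (theta) vanishes in the
    degrees above all delta_k. *)
Lemma irrelevant_nilp f : f \in @irrelevant_ideal K A -> exists m, f ^+ m \in I.
Proof.
move=> fA; pose G e := sum_pred (fun i => hpart (A := A) (i + e)).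
have Gs e i : submod_closed (hpart (A := A) (i + e)) := hpart_submod _.
have fG e : f ^+ e \in G e.
  have Gsum e' (J : finType) (F : J -> A) :
      (forall k, F k \in G e') -> \sum_k F k \in G e'.
    have [v0 vP] := sum_pred_submod (Gs e').
    move=> h; apply: (big_ind (fun x => x \in G e')) => // x y hx hy.
    by rewrite -[x]scale1r; exact: vP.
  elim: e => [|e IHe].
    by rewrite expr0; apply: (sum_pred_part (Gs 0%N) (i := 0%N)); exact: hpart1.
  rewrite exprS; move: IHe fA => /asboolP[N [y [yh ->]]] /asboolP[M [z [zh ->]]].
  rewrite mulr_suml; apply: (Gsum) => i; rewrite mulr_sumr; apply: (Gsum) => j.
  apply: (sum_pred_part (Gs e.+1) (i := (i + j)%N)).
  have -> : (i + j + e.+1 = i.+1 + (j + e))%N by lia.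
  exact: (hpartM (zh i) (yh j)).
pose M := (\max_k delta k).+1.
exists M; have /asboolP[N [y [yh ->]]] := fG M.
apply: gen_ideal_sum => i _; apply: hpart_large (yh i) => k.
by rewrite (@leq_trans M) ?leq_addl // ltnS; exact: leq_bigmax.
Qed.

End LinearForms.

(** * Hilbert series and the h-polynomial *)

Lemma has_dim_le (K : fieldType) (V : lmodType K) (W : {pred V}) n m :
  has_dim W n -> has_dim W m -> (n <= m)%N.
Proof.
move=> [u [uW ufree _]] [v [_ _ vspan]].
have /choice[C uE] : forall i, exists c : 'I_m -> K, u i = \sum_j c j *: v j.
  by move=> i; exact: vspan.
pose M := \matrix_(i < n, j < m) C i j.
rewrite leqNgt; apply/negP => mn.
have : kermx M != 0.
  rewrite -mxrank_eq0 mxrank_ker -lt0n subn_gt0.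
  exact: leq_ltn_trans (rank_leq_col _) mn.
case/rowV0Pn => w wM w0; case/negP: w0; apply/eqP/rowP => i; rewrite mxE.
apply: (ufree (fun i => w 0 i)) => //.
under eq_bigr do rewrite uE scaler_sumr.
rewrite exchange_big big1 //= => j _.
under eq_bigr do rewrite scalerA.
rewrite -scaler_suml; move/sub_kermxP: wM => /rowP/(_ j); rewrite !mxE => wj.
transitivity ((\sum_k w 0 k * M k j) *: v j); last by rewrite wj scale0r.
by congr (_ *: _); apply: eq_bigr => k _; rewrite mxE.
Qed.

Lemma has_dim_uniq (K : fieldType) (V : lmodType K) (W : {pred V}) n m :
  has_dim W n -> has_dim W m -> n = m.
Proof. by move=> hn hm; apply/eqP; rewrite eqn_leq !(@has_dim_le _ _ W). Qed.

Section Monomials.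
Variables (d M : nat).

(** Monomials with exponents below M are indexed by a finite type, over which the
    sum of the t^(degree) factors into a power of a truncated geometric series. *)
Definition mnm_ffun (f : {ffun 'I_d -> 'I_M}) : 'X_{1..d} :=
  [multinom (f i : nat) | i < d].

Lemma mnm_ffun_inj : injective mnm_ffun.
Proof.
move=> f g /mnmP E; apply/ffunP => i; apply: val_inj.
by have := E i; rewrite !mnmE.
Qed.

Lemma mdeg_mnm_ffun f : mdeg (mnm_ffun f) = \sum_i (f i : nat).
Proof. by rewrite mdegE; apply: eq_bigr => i _; rewrite mnmE. Qed.

Lemma homog_ffun (K : fieldType) e (p : {mpoly K[d]}) : p \is e.-homog for mdeg ->
  (e < M)%N -> p = \sum_f p@_(mnm_ffun f) *: 'X_[mnm_ffun f].
Proof.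
move=> hp eM; apply/mpolyP => mu; rewrite raddf_sum /=.
under eq_bigr do rewrite mcoeffZ mcoeffX.
have [muM|muM] := pselect (forall i, mu i < M)%N.
  have muE : mnm_ffun [ffun i => Ordinal (muM i)] = mu.
    by apply/mnmP => i; rewrite mnmE ffunE.
  rewrite (bigD1 [ffun i => Ordinal (muM i)]) //= muE eqxx mulr1 big1 ?addr0 // => f fE.
  rewrite -muE (inj_eq mnm_ffun_inj) (negbTE fE) mulr0.
  by [].
rewrite big1 => [|f _].
  rewrite (dhomog_nemf_coeff hp) //=; apply: contra_notN muM => /eqP mue i.
  apply: leq_ltn_trans eM; rewrite -mue mdegE (bigD1 i) //=.
  exact: leq_addr.
case: eqP => [E|_]; last by rewrite mulr0.
by case: muM => i; rewrite -E mnmE.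
Qed.

End Monomials.

(** Truncating the geometric series at M disturbs its inverse only from degree M
    on. *)
Lemma one_subX_geom (M d : nat) (R : comNzRingType) :
  exists q : {poly R}, (1 - 'X) ^+ d * (\sum_(a < M) 'X^a) ^+ d = 1 + 'X^M * q.
Proof.
rewrite -exprMn.
have -> : (1 - 'X) * \sum_(a < M) 'X^a = 1 - 'X^M :> {poly R}.
  by rewrite -[RHS]opprB subrX1 -mulNr opprB.
elim: d => [|d [q IHd]]; first by exists 0; rewrite mulr0 addr0.
by exists (q - 1 - 'X^M * q); rewrite exprS IHd; ring.
Qed.

Lemma krull_dim_uniq (K : fieldType) (A : gradedAlgType K) d d' :
  krull_dim A d -> krull_dim A d' -> d = d'.
Proof. by case=> [c h] [c' h']; apply/eqP; rewrite eqn_leq h' // h. Qed.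

Section Hilbert.
Variables (K : fieldType) (A : gradedAlgType K) (d : nat) (theta : 'I_d -> A).
Hypothesis theta1 : forall i, theta i \in hpart 1.
Variables (n : nat) (b : 'I_n -> A) (delta : 'I_n -> nat).
Hypotheses (b_hom : forall k, b k \in hpart (delta k)) (b_spans : spans_mod theta b).
Hypothesis b_free : forall g, free_eval theta b g = 0 -> g = 0.
Local Notation S := {mpoly K[d]}.

Section Count.
Variable M : nat.
Local Notation U := ({ffun 'I_d -> 'I_M} * 'I_n)%type.

Definition hilb_set m : {set U} :=
  [set u : U | mdeg (mnm_ffun u.1) + delta u.2 == m]%N.

Lemma hpart_has_dim m : (m < M)%N -> has_dim (hpart (A := A) m) #|hilb_set m|.
Proof.
move=> mM.
pose B (u : U) : A := peval theta 'X_[mnm_ffun u.1] * b u.2.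
exists (fun i => B (enum_val i)); split.
- move=> i; have := enum_valP i; rewrite inE => /eqP uE.
  rewrite -[m in hpart m]uE; apply: hpartM => //.
  by apply: peval_hom => //; rewrite dhomogX.
- move=> c c0 i.
  (* The relation is evaluated on the free module, where it reads off coefficients. *)
  pose E (u : U) : 'rV[S]_n := \row_k (if k == u.2 then 'X_[mnm_ffun u.1] else 0).
  have g0 : \sum_j (c j)%:MP *: E (enum_val j) = 0.
    apply: b_free; rewrite raddf_sum -[RHS]c0; apply: eq_bigr => j _ /=.
    rewrite free_evalZ pevalC mulr_algl; congr (_ *: _).
    rewrite /free_eval (bigD1 (enum_val j).2) //= big1 ?addr0 => [|k kj].
      by rewrite mxE eqxx.
    by rewrite mxE (negbTE kj) raddf0 mul0r.
  move/rowP/(_ (enum_val i).2)/mpolyP/(_ (mnm_ffun (enum_val i).1)) : g0.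
  rewrite mxE mcoeff0 summxE raddf_sum /= (bigD1 i) //= big1 ?addr0 => [|j ji].
    by rewrite !mxE eqxx mcoeffCM mcoeffX eqxx mulr1.
  rewrite !mxE mcoeffCM; case: eqP => [E2|_]; last by rewrite mcoeff0 mulr0.
  rewrite mcoeffX (inj_eq (@mnm_ffun_inj d M)); case: eqP => [E1|_]; last by rewrite mulr0.
  case/negP: ji; apply/eqP/enum_val_inj.
  by move: E1 E2; case: (enum_val j) (enum_val i) => ? ? [? ?] /= -> ->.
move=> x xm; have [g gh <-] := hom_row_span theta1 b_hom b_spans xm.
exists (fun i => (g 0 (enum_val i).2)@_(mnm_ffun (enum_val i).1)).
rewrite -(big_enum_val (A := mem (hilb_set m))
  (fun u : U => (g 0 u.2)@_(mnm_ffun u.1) *: B u)) /=.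
rewrite big_mkcond /=; transitivity (\sum_k \sum_f (if (f, k) \in hilb_set m then
   (g 0 k)@_(mnm_ffun f) *: B (f, k) else 0)); last first.
  by rewrite exchange_big pair_bigA; apply: eq_bigr => -[f k] _.
apply: eq_bigr => k _; have [gk gk0] := gh k.
rewrite [in LHS](homog_ffun (M := M) gk) ?(leq_ltn_trans (leq_subr _ _)) //.
rewrite raddf_sum mulr_suml; apply: eq_bigr => f _ /=.
rewrite inE /= pevalZ -scalerAl; case: eqP => // ne.
have [mk|mk] := ltnP m (delta k); first by rewrite gk0 // mcoeff0 scale0r.
rewrite (dhomog_nemf_coeff gk) ?scale0r //=.
by apply/eqP => E; apply: ne; rewrite E subnK.
Qed.

Lemma hilb_poly m :
  ((\sum_k 'X^(delta k)) * (\sum_(a < M) 'X^a) ^+ d : {poly int})`_m =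
  (#|hilb_set m|)%:Z.
Proof.
rewrite -[d in _ ^+ d](card_ord d) -prodr_const bigA_distr_bigA /=.
rewrite big_distrlr /= coef_sum.
under eq_bigr => k _ do rewrite coef_sum.
rewrite exchange_big pair_bigA /= -natz -sum1_card natr_sum [RHS]big_mkcond /=.
apply: eq_bigr => -[f k] _ /=; rewrite inE /= mdeg_mnm_ffun.
rewrite -(big_morph (fun e => 'X^e : {poly int}) (exprD 'X) (expr0 'X)) -exprD coefXn.
by rewrite addnC eq_sym; case: eqP.
Qed.

End Count.

(** By freeness Hilb(A, t) is the sum of the t^(delta_k) divided by (1 - t)^d. Only
    the terms up to degree m matter, so 1 / (1 - t) can be truncated there. *)
Lemma h_coef h : krull_dim A d -> h_polynomial A h ->
  forall m, h`_m = \sum_k (delta k == m)%:R.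
Proof.
move=> dimA [d' [H [dim' HH hE]]] m.
have dd := krull_dim_uniq dim' dimA.
rewrite {}dd in hE.
pose P : {poly int} := (\sum_k 'X^(delta k)) * (\sum_(a < m.+1) 'X^a) ^+ d.
transitivity ((1 - 'X) ^+ d * P)`_m.
  rewrite hE coefM; apply: eq_bigr => k _; congr (_ * _).
  rewrite /P hilb_poly; congr Posz.
  by apply: has_dim_uniq (HH _) (hpart_has_dim _); rewrite ltnS leq_subr.
rewrite /P mulrCA; have [q ->] := one_subX_geom m.+1 d int.
rewrite mulrDr mulr1 mulrCA coefD coefXnM ltnSn addr0 coef_sum.
by apply: eq_bigr => k _; rewrite coefXn eq_sym.
Qed.

(** The nonzero coefficient h_m at m = delta_k bounds delta_k by the degree
    of h. *)
Lemma delta_le h k : krull_dim A d -> h_polynomial A h ->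
  (delta k <= (size h).-1)%N.
Proof.
move=> dimA hA; have := h_coef dimA hA (delta k).
rewrite (bigD1 k) //= eqxx => hk.
have h0 : h`_(delta k) != 0.
  by rewrite hk -natr_sum -natrD natz.
rewrite -ltnS; apply: leq_trans (leqSpred _).
by rewrite ltnNge; apply: contra h0 => /(nth_default 0) ->.
Qed.

End Hilbert.

(** The projection, with the graded algebra as its declared target. *)
Definition gquot_pi (K : fieldType) (A : gradedAlgType K) n (f : 'I_n -> A)
    (fP : homogeneous_pos f) (x : A) : gquot fP :=
  (\pi_({ideal_quot (hideal fP)}) x)%qT.

(** * Lefschetz elements of the Veronese quotient *)

Section Assembly.
Variables (K : fieldType) (A : gradedAlgType K) (d : nat) (Theta : lsop A d).
Local Notation theta1 := (lsop_linear Theta).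
Local Notation S := {mpoly K[d]}.

Lemma lsop_spans : exists n (x : 'I_n -> A), spans_mod Theta x.
Proof.
have [n [q [_ _ qspan]]] := lsop_finite Theta.
have /choice[x xE] := fun i => gquotP (q i).
exists n, x => y; have [c cE] := qspan (gquot_pi _ y) isT; exists c.
rewrite -[_ \in _](gquot_eq (linear_homogeneous theta1)); apply/eqP.
rewrite [LHS]cE.
elim/big_rec2: _ => [|i u v _ ->]; first by rewrite gquot0.
by rewrite gquotD gquotZ xE.
Qed.

Lemma cohen_macaulay_free h : cohen_macaulay A -> krull_dim A d -> h_polynomial A h ->
  exists n (b : 'I_n -> A) (delta : 'I_n -> nat),
    [/\ forall k, b k \in hpart (delta k), spans_mod Theta b,
        forall g, free_eval Theta b g = 0 -> g = 0
      & forall k, (delta k <= (size h).-1)%N].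
Proof.
move=> [d' dim' [[f [fA freg]] _]] dimA hA.
have dd := krull_dim_uniq dim' dimA.
rewrite {}dd {d' dim'} in f fA freg.
have [n0 [x0 x0s]] := lsop_spans.
have [n [b [delta [bh bs bf]]]] := homog_basis x0s.
have fnil i : exists m, f i ^+ m \in gen_ideal Theta.
  exact: (irrelevant_nilp theta1 bh bs (fA i)).
have inj := free_eval_injective (regular_kexact fnil freg)
  (free_eval_span theta1 bh bs) bf.
exists n, b, delta; split=> // k.
exact: (delta_le theta1 bh bs inj k dimA hA).
Qed.

Variables (r : nat) (r_gt0 : (0 < r)%N).
Hypothesis K_char0 : [pchar K] =i pred0.
Local Notation J := (gen_ideal (fun i => Theta i ^+ r)).
Local Notation N := (d * r.-1)%N.

Definition theta_sum : A := \sum_i Theta i.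

Lemma theta_sumX_hpart : theta_sum ^+ r \in hpart (1 * r).
Proof. by rewrite mulnC; apply: hpartX; apply: hpart_sumr => i _; exact: theta1. Qed.

Lemma peval_lform : peval Theta (lform K d) = theta_sum.
Proof. by rewrite raddf_sum; apply: eq_bigr => i _; exact: pevalX. Qed.

Section WithBasis.
Variables (n : nat) (b : 'I_n -> A) (delta : 'I_n -> nat).
Hypotheses (b_hom : forall k, b k \in hpart (delta k)) (b_spans : spans_mod Theta b).
Hypothesis b_free : forall g, free_eval Theta b g = 0 -> g = 0.

Lemma box_free_ideal (g : 'rV[S]_n) :
  (forall k, box_free r (g 0 k)) -> free_eval Theta b g \in J.
Proof.
move=> hg; have /choice[u uE] := fun k => proj1 (box_freeP _ _) (hg k).
apply/asboolP; exists (fun i => \sum_k peval Theta (u k i) * b k).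
rewrite /free_eval; under eq_bigr => k _ do rewrite uE raddf_sum /= mulr_suml.
rewrite exchange_big; apply: eq_bigr => i _ /=; rewrite mulr_suml.
apply: eq_bigr => k _; rewrite rmorphM rmorphXn /= pevalX -mulrA mulrC.
by [].
Qed.

Lemma ideal_box_free g : free_eval Theta b g \in J -> forall k, box_free r (g 0 k).
Proof.
move=> /asboolP[c cE] k.
have /choice[u uE] := fun i => free_eval_span theta1 b_hom b_spans (c i).
have : g - \sum_i 'X_i ^+ r *: u i = 0.
  apply: b_free; rewrite raddfB /= cE [free_eval _ _ _]raddf_sum /= -sumrB big1 // => i _.
  by rewrite free_evalZ rmorphXn /= pevalX uE mulrC subrr.
move/subr0_eq ->; apply/box_freeP; exists (fun i => u i 0 k).
by rewrite summxE; apply: eq_bigr => i _; rewrite mxE.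
Qed.

(** In coordinates over b this is multiplication by lform^r, applied in degrees
    m - delta_k <= m. *)
Lemma theta_sumX_injective m x : (2 * m + r <= N)%N -> x \in hpart m ->
  theta_sum ^+ r * x \in J -> x \in J.
Proof.
move=> mN xm; have [g gh <-] := hom_row_span theta1 b_hom b_spans xm.
rewrite -peval_lform -rmorphXn -free_evalZ => /ideal_box_free hg.
apply: box_free_ideal => k; have := hg k; rewrite mxE.
by apply: (lefschetz_inj K_char0 r_gt0 (gh k).1); lia.
Qed.

(** The k-th coordinate of y has degree m + r - delta_k >= m + r - D, whence the
    bound. *)
Lemma theta_sumX_surjective D m y : (forall k, delta k <= D)%N ->
  (N + r + 2 * D <= 2 * (m + r))%N -> y \in hpart (m + r) ->
  exists2 x, x \in hpart m & y - theta_sum ^+ r * x \in J.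
Proof.
move=> hD mN ym; have [g gh <-] := hom_row_span theta1 b_hom b_spans ym.
have /choice[u uP] : forall k, exists u : S,
    [/\ u \is (m - delta k).-homog for mdeg, (m < delta k)%N -> u = 0
      & box_free r (g 0 k - lform K d ^+ r * u)].
  move=> k; have := hD k => dk.
  have [|u [uh u0 uQ]] := lefschetz_surj K_char0 r_gt0 (k := r) (gh k).1; first by lia.
  exists u; split=> //.
    by have -> : (m - delta k = m + r - delta k - r)%N by lia.
  by move=> mk; apply: u0; lia.
exists (free_eval Theta b (\row_k u k)).
  by apply: (free_eval_hom theta1 b_hom) => k; rewrite mxE; case: (uP k).
rewrite -peval_lform -rmorphXn -free_evalZ -raddfB; apply: box_free_ideal => k.
by rewrite !mxE; case: (uP k).
Qed.

End WithBasis.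

Local Notation V := (veronese A r_gt0).
Local Notation B := (veronese_quot Theta r_gt0).
Local Notation hP := (lsop_pow_homogeneous Theta r_gt0).

Lemma veronese_mem i x : x \in hpart (A := A) (i * r) -> x \in veronese_pred A r.
Proof. exact: (sum_pred_part (fun i => hpart_submod (i * r))). Qed.

Lemma veronese_val_sum (I : Type) (s : seq I) (P : pred I) (F : I -> V) :
  veronese_val (\sum_(i <- s | P i) F i) = \sum_(i <- s | P i) veronese_val (F i).
Proof. exact: (big_morph (@veronese_val K A r r_gt0)). Qed.

(** For v in degree i r, only the components of degree i r - r of the
    coefficients contribute, and these belong to the Veronese subalgebra. *)
Lemma veronese_ideal i (v : V) : v \in hpart i ->
  (v \in gen_ideal (lsop_pow Theta r_gt0)) = (veronese_val v \in J).
Proof.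
move=> vi; have {}vi : veronese_val v \in hpart (i * r) := vi.
apply/idP/idP => /asboolP[c cE]; apply/asboolP.
  exists (fun k => veronese_val (c k)); rewrite cE.
  by rewrite veronese_val_sum.
have cv k : (if (r <= i * r)%N then hcomp (c k) (i * r - r) else 0) \in veronese_pred A r.
  apply: (veronese_mem (i := i.-1)); case: ifP => _; last exact: hpart0.
  by rewrite -subn1 mulnBl mul1n; exact: hcomp_hpart.
exists (fun k => Veronese r_gt0 (cv k)); apply: val_inj.
rewrite /= veronese_val_sum /=.
have := hcomp_id (i * r) vi; rewrite eqxx => <-.
rewrite cE hcomp_sum; apply: eq_bigr => k _.
have tr : Theta k ^+ r \in hpart r by rewrite -{2}[r]mul1n; exact: lsop_pow_hpart.
by rewrite (hcompM _ _ tr); case: ifP => //; rewrite mul0r.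
Qed.

Definition lefschetz_ver : V := Veronese r_gt0 (veronese_mem theta_sumX_hpart).
Definition lefschetz_elt : B := gquot_pi hP lefschetz_ver.

Lemma lefschetz_verM i (v : V) : v \in hpart i -> lefschetz_ver * v \in hpart i.+1.
Proof. exact: (hpartM (i := 1) (theta_sumX_hpart : lefschetz_ver \in hpart 1)). Qed.

Lemma lefschetz_elt_hpart : lefschetz_elt \in hpart 1.
Proof. by apply/asboolP; exists lefschetz_ver => //; exact: theta_sumX_hpart. Qed.

Section Lefschetz_quot.
Variables (n : nat) (b : 'I_n -> A) (delta : 'I_n -> nat).
Hypotheses (b_hom : forall k, b k \in hpart (delta k)) (b_spans : spans_mod Theta b).
Hypothesis b_free : forall g, free_eval Theta b g = 0 -> g = 0.

Lemma lefschetz_elt_injective i : (i.*2.+1 * r <= N)%N -> mul_injective lefschetz_elt i.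
Proof.
move=> iN q q' /asboolP[x xi ->] /asboolP[y yi ->] /eqP.
rewrite -!gquotM gquot_eq -mulrBr => wxy; apply/eqP; rewrite gquot_eq.
have xyi : x - y \in hpart i.
  by rewrite addrC -scaleN1r; apply: hpartD => //; exact: hpartZ.
rewrite (veronese_ideal xyi).
apply: (theta_sumX_injective b_hom b_spans b_free (m := (i * r)%N)) => //.
  by move: iN; rewrite -mul2n mulSn mulnA addnC.
by rewrite /hideal (veronese_ideal (lefschetz_verM xyi)) in wxy.
Qed.

Lemma lefschetz_elt_surjective D i : (forall k, delta k <= D)%N ->
  (N + 2 * D <= i.*2.+1 * r)%N -> mul_surjective lefschetz_elt i.
Proof.
move=> hD iN q /asboolP[y yi ->].
have yi' : veronese_val y \in hpart (i * r + r) by rewrite addnC -mulSn.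
have [|x xi xE] := theta_sumX_surjective b_hom b_spans hD _ yi'.
  by have := iN; have -> : (i.*2.+1 * r = 2 * (i * r) + r)%N by [
    rewrite mulSn -mul2n mulnA addnC]; lia.
exists (gquot_pi hP (Veronese r_gt0 (veronese_mem xi))).
  by apply/asboolP; exists (Veronese r_gt0 (veronese_mem xi)).
apply/esym/eqP; rewrite -gquotM gquot_eq (veronese_ideal (i := i.+1)) //.
rewrite addrC -scaleN1r; apply: hpartD => //; apply: hpartZ.
exact: lefschetz_verM.
Qed.

End Lefschetz_quot.

End Assembly.

Lemma veronese_quot_deg0 (K : fieldType) (A : gradedAlgType K) d
    (Theta : lsop A d) r (r_gt0 : (0 < r)%N) :
  (forall x : A, x \in hpart 0 -> exists a : K, x = a%:A) ->
  forall q : veronese_quot Theta r_gt0, q \in hpart 0 -> exists a : K, q = a%:A.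
Proof.
move=> A0 q /asboolP[v v0 ->]; have [a va] := A0 _ (v0 : veronese_val v \in hpart 0).
exists a; rewrite -gquot1 -gquotZ; congr (gquot_pi _ _); exact: val_inj.
Qed.

(** The pivot has to satisfy 1 <= p < s. If p = 0 it can be moved to 1: as w
    maps B_(s-1) onto B_s, it is nonzero, hence injective on B_0 = K. If
    p >= s it can be moved to s - 1: the targets past the top degree vanish. *)
Lemma almost_weak_lefschetz_of_pivot (K : fieldType) (B : gradedAlgType K) (w : B) p s :
  (forall x : B, x \in hpart 0 -> exists a : K, x = a%:A) -> w \in hpart 1 ->
  top_degree B s -> (2 <= s)%N ->
  (forall i, (i < p)%N -> mul_injective w i) ->
  (forall i, (p < i)%N -> mul_surjective w i) -> almost_weak_lefschetz B.
Proof.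
move=> B0 w1 [[x xs x0] stop] s2 inj surj; exists s.
split; first by split=> //; exists x.
case: p inj surj => [|p] inj surj.
  exists 1%N, w; split=> //; last by move=> i i1; apply: surj; exact: ltnW.
  move=> i; rewrite ltnS leqn0 => /eqP ->.
  have w0 : w != 0.
    apply: contraNneq x0 => w0; case: s xs s2 {stop} => // s xs s2.
    by have [y _ <-] := surj s s2 x xs; rewrite w0 mul0r.
  move=> _ _ /B0[a ->] /B0[b ->] /eqP.
  rewrite -!scalerAr !mulr1 -subr_eq0 -scalerBl scaler_eq0 (negbTE w0) orbF subr_eq0.
  by move=> /eqP ->.
have [ps|sp] := ltnP p.+1 s; first by exists p.+1, w; split.
exists s.-1, w; split=> //; first by lia.
  by move=> i i_s; apply: inj; lia.
move=> i si y yi; exists 0; first exact: hpart0.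
by rewrite mulr0 (stop i.+1 _ y yi) //; lia.
Qed.

Theorem theorem1p2 (K : fieldType) (K_char0 : [pchar K] =i pred0)
    (A : gradedAlgType K) (A_std : standard_graded A) (A_cm : cohen_macaulay A)
    (d : nat) (A_dim : krull_dim A d) (Theta : lsop A d)
    (r : nat) (r_ge1 : (1 <= r)%N)
    (h : {poly int}) (A_h : h_polynomial A h) :
  let deg_h := (size h).-1 in
  let B := veronese_quot Theta r_ge1 in
  [/\ (deg_h <= r)%N ->
        forall s, top_degree B s -> (2 <= s)%N -> almost_weak_lefschetz B,
      ~~ odd d -> (maxn d (2 * deg_h - d) <= r)%N -> weak_lefschetz B
    & odd d -> (d <= 2 * r)%N -> (2 * deg_h <= d)%N -> weak_lefschetz B].
Proof.
move=> deg_h B.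
have [n [b [delta [bh bs bf bD]]]] := cohen_macaulay_free Theta A_cm A_dim A_h.
pose w : B := lefschetz_elt Theta r_ge1.
have w1 : w \in hpart 1 := lefschetz_elt_hpart Theta r_ge1.
have inj i : (i.*2.+1 * r <= d * r.-1)%N -> mul_injective w i.
  exact: (lefschetz_elt_injective K_char0 bh bs bf).
have surj i : (d * r.-1 + 2 * deg_h <= i.*2.+1 * r)%N -> mul_surjective w i.
  exact: (lefschetz_elt_surjective K_char0 bh bs bD).
have wlp : (forall i, (i.*2.+1 * r <= d * r.-1) ||
    (d * r.-1 + 2 * deg_h <= i.*2.+1 * r))%N -> weak_lefschetz B.
  by move=> H; exists w => // i; case/orP: (H i); [left; exact: inj|right; exact: surj].
have dr : (d * r.-1 = d * r - d)%N by rewrite -subn1 mulnBr muln1.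
split.
- move=> hr s stop s2.
  have ex_p : exists i, (d * r.-1 < i.*2.+1 * r)%N.
    exists (d * r)%N; apply: (@leq_trans ((d * r).*2.+1 * 1)%N); last first.
      by rewrite leq_mul2l r_ge1 orbT.
    by rewrite muln1 ltnS dr; lia.
  (* p is the first degree outside the injective range; from p + 1 on, (2i+1) r has
     grown by at least 2 r >= 2 deg h. *)
  case: (ex_minnP ex_p) => p pr pmin.
  apply: (almost_weak_lefschetz_of_pivot (w := w) (p := p) _ w1 stop s2).
  + by case: A_std => A0 _ _; exact: veronese_quot_deg0.
  + by move=> i ip; apply: inj; rewrite leqNgt; apply: contraL ip => /pmin; rewrite -leqNgt.
  + move=> i ip; apply: surj.
    have : (p.*2.+3 * r <= i.*2.+1 * r)%N by rewrite leq_mul2r; lia.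
    have : (p.*2.+3 * r = p.*2.+1 * r + 2 * r)%N by rewrite -mulnDl; congr (_ * _)%N; lia.
    lia.
- move=> d_even; rewrite geq_max => /andP[dr1 hr]; apply: wlp => i.
  (* r >= d makes w injective for i < d / 2, and r >= 2 deg h - d makes it
     surjective from i = d / 2 on. *)
  have [k dk] : exists k, d = k.*2 by exists d./2; rewrite even_halfK.
  rewrite dr dk in dr1 hr *; have [ik|ki] := ltnP i k; apply/orP; [left|right].
    have : (i.*2.+1 * r <= k.*2.-1 * r)%N by rewrite leq_mul2r; lia.
    have : (k.*2.-1 * r = k.*2 * r - r)%N by rewrite -subn1 mulnBl mul1n.
    lia.
  have : (k.*2.+1 * r <= i.*2.+1 * r)%N by rewrite leq_mul2r; lia.
  have : (k.*2.+1 * r = k.*2 * r + r)%N by rewrite mulSn addnC.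
  have : (k.*2 <= k.*2 * r)%N by rewrite leq_pmulr.
  lia.
- move=> d_odd dr1 hr; apply: wlp => i.
  (* 2 r >= d makes w injective for i < (d - 1) / 2, and 2 deg h <= d makes it
     surjective from i = (d - 1) / 2 on. *)
  have [k dk] : exists k, d = k.*2.+1 by exists d./2; lia.
  rewrite dr dk in dr1 hr *; have [ik|ki] := ltnP i k; apply/orP; [left|right].
    have : (i.*2.+1 * r <= k.*2.-1 * r)%N by rewrite leq_mul2r; lia.
    have : (k.*2.-1 * r + 2 * r = k.*2.+1 * r)%N by rewrite -mulnDl; congr (_ * _)%N; lia.
    lia.
  have : (k.*2.+1 * r <= i.*2.+1 * r)%N by rewrite leq_mul2r; lia.
  have : (k.*2.+1 <= k.*2.+1 * r)%N by rewrite leq_pmulr.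
  lia.
Qed.
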